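(* Let $C_\varphi$ be the composition operator on the Zen space $A^2_\nu$, where $\varphi(s)=\mu s$ with $\mu>1$ and $\nu$ determines the weight $w$ on $(0,\infty)$. Then the essential spectrum $\sigma_e(C_\varphi)$ contains $\mu^\alpha$ for every $\alpha\in\mathbb{C}$ such that $$\int_0^\infty\frac{|t^\alpha|^2}{w(t)}\,dt<\infty .$$
   Context: $\mathbb{C}_+=\{z\in\mathbb{C}:\operatorname{Re}z>0\}$ is the right half-plane. Let $\nu$ be a positive regular Borel measure on $[0,\infty)$ satisfying the doubling condition $\sup_{t>0}\nu[0,2t)/\nu[0,t)<\infty$. The Zen space $A^2_\nu$ consists of all analytic $F:\mathbb{C}_+\to\mathbb{C}$ such that $$\|F\|^2=\sup_{\epsilon>0}\int_{\overline{\mathbb{C}_+}}|F(s+\epsilon)|^2\,d\nu(x)\,dy<\infty ,\qquad s=x+iy .$$ The weight determined by $\nu$ is $w(t)=2\pi\int_0^\infty e^{-2rt}\,d\nu(r)$ for $t>0$ (the integral being over $[0,\infty)$, including any atom of $\nu$ at $0$). The Laplace transform is an isometric isomorphism from $L^2(0,\infty,w(t)\,dt)$ onto $A^2_\nu$. The composition operator is $C_\varphi f=f\circ\varphi$. The essential spectrum $\sigma_e$ is the set of $\lambda\in\mathbb{C}$ such that $C_\varphi-\lambda I$ is not Fredholm. For $t>0$, $\mu>0$ and $\alpha\in\mathbb{C}$, $t^\alpha=e^{\alpha\log t}$ and $\mu^\alpha=e^{\alpha\log\mu}$ with real logarithms. *)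

(* Defs.v *)
From HB Require Import structures.
From mathcomp Require Import all_boot all_order all_algebra.
From mathcomp Require Import all_classical all_reals all_analysis.
From mathcomp Require Import complex.

Set Implicit Arguments.
Unset Strict Implicit.
Unset Printing Implicit Defensive.

Import Order.TTheory GRing.Theory Num.Theory.
Import numFieldNormedType.Exports.

Local Open Scope classical_set_scope.
Local Open Scope ring_scope.
Local Open Scope complex_scope.

Section Fredholm.
Context {R : realType} {K : numFieldType} {V : lmodType K}.
Implicit Types (H W : set V) (N : V -> \bar R) (T : V -> V).

(* The quotient of H by W is finite-dimensional: finitely many vectors of H
   span H modulo W. *)
Definition finite_dim_mod H W : Prop :=
  exists (n : nat) (v : 'I_n -> V), (forall i, H (v i)) /\
    forall x, H x -> exists c : 'I_n -> K, W (x - \sum_(i < n) c i *: v i).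

Definition kernel_on H T : set V := [set x | H x /\ T x = 0].

Definition seq_closed_in H N W : Prop :=
  forall (u : nat -> V) (y : V), (forall n, W (u n)) -> H y ->
    N (u n - y) @[n --> \oo] --> 0%E -> W y.

(* H is a linear subspace of V normed by N, and T is a linear map on V which
   restricts to a bounded operator of H into itself; this operator is meant.
   Its boundedness is not a clause here, so that a failure of boundedness could
   never put a point into the essential spectrum. *)
Definition fredholm H N T : Prop :=
  [/\ finite_dim_mod (kernel_on H T) [set 0],
      seq_closed_in H N (T @` H)
    & finite_dim_mod H (T @` H)].

Definition essential_spectrum H N T : set K :=
  [set lambda | ~ fredholm H N (fun x => T x - lambda *: x)].

End Fredholm.

Section ZenSpace.
Context {R : realType}.
Implicit Types (z a : R[i]) (t : R).

Definition cexp z : R[i] :=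
  (expR (complex.Re z))%:C * (cos (complex.Im z) +i* sin (complex.Im z)).

(* t ^ a for t > 0, with the real logarithm of t. *)
Definition cpow t a : R[i] := cexp (a * (ln t)%:C).

(* A Borel measure on [0, +oo[ is a measure on the Borel sets of R which
   vanishes on ]-oo, 0[. *)
Definition supported_on_nonneg (nu : {measure set (measurableTypeR R) -> \bar R})
  : Prop := nu `]-oo, 0[%classic = 0%E.

Definition regular_borel (nu : {measure set (measurableTypeR R) -> \bar R})
  : Prop :=
  [/\ forall A : set R, compact A -> (nu A < +oo)%E,
      forall A : set (measurableTypeR R), measurable A ->
        nu A = ereal_inf [set nu U | U in [set U : set R | open U /\ A `<=` U]]
    & forall A : set (measurableTypeR R), measurable A ->
        nu A = ereal_sup
          [set nu C | C in [set C : set R | compact C /\ C `<=` A]]].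

(* The positivity clause makes the quotients meaningful: in the library
   0 / 0 is 0, so without it the zero measure would be doubling. *)
Definition doubling (nu : {measure set (measurableTypeR R) -> \bar R}) : Prop :=
  (forall t, 0 < t -> (0 < nu `[0%R, t[%classic)%E) /\
  (ereal_sup [set nu `[0%R, (2 * t)%R[%classic / nu `[0%R, t[%classic | t in [set t | (0 < t)%R]]
     < +oo)%E.

Definition weight (nu : {measure set (measurableTypeR R) -> \bar R}) t : \bar R :=
  ((2 * pi)%:E * \int[nu]_(r in `[0%R, +oo[%classic) (expR (- (2 * r * t)))%:E)%E.

Definition halfplane : Type := {s : R[i] | 0 < complex.Re s}.

Definition extend (F : halfplane -> R[i]) z : R[i] :=
  oapp F 0 (insub z : option halfplane).

(* Complex differentiability at every point of the open half-plane, where the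
   value of the extension outside the half-plane is irrelevant. *)
Definition analytic (F : halfplane -> R[i]) : Prop :=
  forall s : halfplane, derivable (extend F : (R[i])^o -> (R[i])^o) (val s) 1.

Definition zen_norm (nu : {measure set (measurableTypeR R) -> \bar R})
    (F : halfplane -> R[i]) : \bar R :=
  sqrte (ereal_sup
    [set (\int[(nu \x (@lebesgue_measure R))%E]_(p in [set p | (0 <= p.1)%R])
            ((Normc.normc (extend F ((p.1 + e) +i* p.2))) ^+ 2)%:E)%E
    | e in [set e : R | 0 < e]]).

Definition zen_space (nu : {measure set (measurableTypeR R) -> \bar R})
  : set (halfplane -> R[i]) :=
  [set F | analytic F /\ (zen_norm nu F < +oo)%E].

Definition composition_op (phi : halfplane -> halfplane)
    (F : halfplane -> R[i]) : halfplane -> R[i] := F \o phi.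

End ZenSpace.

Arguments halfplane R : clear implicits.

(* Main.v *)
From HB Require Import structures.
Require Import Defs.
From mathcomp Require Import all_boot all_order all_algebra.
From mathcomp Require Import all_classical all_reals all_analysis.
From mathcomp Require Import complex measurable_realfun.
From mathcomp Require Import ring lra.

Import Order.TTheory GRing.Theory Num.Theory.
Import numFieldNormedType.Exports.
Import ComplexField.Normc.

Set Implicit Arguments.
Unset Strict Implicit.
Unset Printing Implicit Defensive.

Local Open Scope classical_set_scope.
Local Open Scope ring_scope.
Local Open Scope complex_scope.

(** Write [lam = mu ^ alpha], [V x] for the mass of [0, x[ under [nu], [w] for the
weight and [T h = h \o phi - lam *: h].
The range of [T] has infinite codimension in the Zen space, so [T] is not
Fredholm. Two things are behind this.

Applying [T] is a telescoping operation. For [n : nat] the two-sided sum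

  [S_n(g)(z) = \sum_(-n <= k < n) lam ^ (-k-1) * g (mu ^ k * z)]

of [g = T h] collapses to
[lam ^ (-n) * h (mu ^ n * z) - lam ^ n * h (mu ^ (-n) * z)]
([two_sided_sum_telescope]). Each of these two terms tends to [0] in the mean
square over every box of the half-plane. Indeed, averaging the inequality that
defines the norm over the shift [epsilon] bounds an area integral of [|h|^2]
over a vertical strip ([box_area_bound]), which after rescaling by [c] reads

  [\int_box |h (c z)|^2 = O (1 / (c * V c))].

Since [nu] is doubling, [w t = O (V (1 / t))] ([weight_le_initial_mass]); hence
the integrability of [|t ^ alpha|^2 / w t], tested on the disjoint intervals
from [1 / c] to [mu / c] for [c = mu ^ n], [n] an integer, forces the rate
[c ^ (- 2 Re alpha) / (c * V c)] to vanish as [n] tends to either infinity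
([decay_along]). The same fact gives [|lam| < 1] ([normc_cpow_lt1]).

On the other hand, for every [N] there are [N + 1] functions
[x_j z = (z + eta - i q ^ j) ^ (-m)], with [q ^ (N + 1) = mu], which belong to
the Zen space for [m] large by the doubling condition, and for which no
combination has small two-sided sums. As no two of the points [mu ^ k * q ^ j]
coincide, on a small box near [i q ^ j] the sum [S_n(x_j)] is dominated by its
term [k = 0], of size at least [(4 * eta) ^ (-m)], while everything else stays
bounded as [eta] tends to [0] ([test_family]).

If the range of [T] had codimension at most [N], some combination of the [x_j]
with coefficients bounded by [1], one of them equal to [1], would be a
combination of functions [T h_j]. Its two-sided sums would be at least [1] in
modulus on a fixed box, and would tend to [0] in the mean square over it. *)

(** * Integrals of nonnegative functions *)

(** The integral of a nonnegative function is a supremum over the simple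
functions below it, which gives monotonicity for arbitrary integrands, such as
the quotient by the weight. *)
Lemma ge0_integral_mono d (T : measurableType d) (R : realType)
    (m : {measure set T -> \bar R}) (D : set T) (f g : T -> \bar R) :
  (forall x, D x -> (0 <= f x)%E) -> (forall x, D x -> (f x <= g x)%E) ->
  (\int[m]_(x in D) f x <= \int[m]_(x in D) g x)%E.
Proof.
move=> f0 fg; have g0 x : D x -> (0 <= g x)%E.
  by move=> Dx; exact: le_trans (f0 _ Dx) (fg _ Dx).
rewrite !ge0_integralE//; apply: le_ereal_sup => _ [h hf <-].
exists h => // x; apply: le_trans (hf x) _; exact: lee_restrict.
Qed.

Section affine.
Variables (R : realType) (a b : R).
Hypothesis a0 : 0 < a.

Let phi (x : measurableTypeR R) : measurableTypeR R := a * x + b.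

Let mphi : measurable_fun [set: measurableTypeR R] phi.
Proof. by apply: measurable_funD => //; exact: measurable_funM. Qed.

Let pf : {measure set (measurableTypeR R) -> \bar R}.
Proof.
by refine [the {measure set _ -> \bar R} of pushforward (@lebesgue_measure R) phi].
Defined.

Let M := mscale (NngNum (ltW a0)) pf.

Let leb_affine (A : set R) :
  measurable A -> lebesgue_measure A = M A.
Proof.
apply: lebesgue_measure_unique => _ [[c d] _ <-] /=.
rewrite /M /mscale /pf /pushforward /= /pushforward.
have -> : phi @^-1` `]c, d]%classic =
    `](c - b) / a, (d - b) / a]%classic.
  apply/seteqP; split => x /=; rewrite !in_itv /= /phi.
    by rewrite ltr_pdivrMr// ler_pdivlMr// mulrC ltrBlDr lerBrDr.
  by rewrite ltr_pdivrMr// ler_pdivlMr// mulrC ltrBlDr lerBrDr.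
rewrite !lebesgue_measure_itv /= !lte_fin ltr_pM2r ?invr_gt0// ltrD2r.
case: ifP => _; rewrite ?mule0// -EFinM; congr EFin.
by field; rewrite gt_eqF.
Qed.

(** Lebesgue measure agrees on intervals with [a] times its image under
[x |-> a * x + b], hence everywhere, by uniqueness. *)
Lemma ge0_integral_affine (f : R -> \bar R) :
  measurable_fun setT (f : measurableTypeR R -> \bar R) ->
  (forall x, 0 <= f x)%E ->
  (\int[lebesgue_measure]_x f x =
   a%:E * \int[lebesgue_measure]_x f (a * x + b)%R)%E.
Proof.
move=> mf f0.
rewrite (eq_measure_integral M); last by move=> A mA _; exact: leb_affine.
by rewrite ge0_integral_mscale//= ge0_integral_pushforward.
Qed.

End affine.

(** An open set of the plane is the union of the countably many boxes with
rational corners that it contains. *)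
Lemma open_measurable_plane (R : realType) (U : set (R * R)) : open U ->
  measurable (U : set (measurableTypeR R * measurableTypeR R)).
Proof.
move=> oU.
pose box (q : rat * rat * rat * rat) : set (R * R) :=
  `]ratr q.1.1.1, ratr q.1.1.2[%classic `*` `]ratr q.1.2, ratr q.2[%classic.
pose F n := if unpickle n is Some q then
  if pselect (box q `<=` U) then box q else set0 else set0.
have -> : U = \bigcup_n F n.
  apply/seteqP; split => [p Up|p [n _]]; last first.
    rewrite /F; case: unpickle => // q.
    by case: pselect => [qU /= pq|//]; exact: (qU p pq).
  have /nbhs_ballP[e /= e0 eU] : nbhs p U by exact: open_nbhs_nbhs.
  have /rat_in_itvoo[a /[!in_itv]/= /andP[a1 a2]] : p.1 - e < p.1.
    by rewrite ltrBlDr ltrDl.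
  have /rat_in_itvoo[b /[!in_itv]/= /andP[b1 b2]] : p.1 < p.1 + e.
    by rewrite ltrDl.
  have /rat_in_itvoo[c /[!in_itv]/= /andP[c1 c2]] : p.2 - e < p.2.
    by rewrite ltrBlDr ltrDl.
  have /rat_in_itvoo[d /[!in_itv]/= /andP[d1 d2]] : p.2 < p.2 + e.
    by rewrite ltrDl.
  exists (pickle (a, b, c, d)); [exact: I|rewrite /F pickleK].
  case: pselect => [qU|nU].
    by split; rewrite /= in_itv/= ?a2 ?b1 ?c2 ?d1.
  case: nU => q [] /=; rewrite !in_itv /= => /andP[qa qb] /andP[qc qd].
  apply: eU; split; rewrite /ball/= ltr_norml; apply/andP; split; lra.
apply: bigcupT_measurable => n; rewrite /F; case: unpickle => // q.
by case: pselect => [qU|nU]; [exact: measurableX|exact: measurable0].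
Qed.

Lemma continuous_measurable_fun_plane (R : realType) (D : set (R * R))
    (f : R * R -> R) : open D -> {in D, continuous f} ->
  measurable_fun (D : set (measurableTypeR R * measurableTypeR R))
    (f : measurableTypeR R * measurableTypeR R -> measurableTypeR R).
Proof.
move=> oD cf mD; apply: (measurability _ (RGenOInfty.measurableE R)) => //.
move=> _ [_ [a ->] <-]; apply: open_measurable_plane.
rewrite openE => p [Dp /= fp]; apply: filterI; first exact: open_nbhs_nbhs.
apply: (cf p (mem_set Dp)); apply: open_nbhs_nbhs; split => //.
Qed.

(** * The modulus of a complex number, and of an analytic function *)

Section normc.
Variable R : realType.
Implicit Types z w : R[i].

Lemma normcE z : `|z| = (normc z)%:C. Proof. by []. Qed.

Lemma normc_ge0 z : 0 <= normc z. Proof. by rewrite -ler0c -normcE. Qed.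

Lemma ler_normcD z w : normc (z + w) <= normc z + normc w.
Proof. by rewrite -lecR rmorphD -!normcE ler_normD. Qed.

Lemma normcN z : normc (- z) = normc z.
Proof. by apply: complexI; rewrite -!normcE normrN. Qed.

Lemma normc_real (x : R) : normc x%:C = `|x|.
Proof. by rewrite /= expr0n /= addr0 sqrtr_sqr. Qed.

Lemma ler_distc_dist z w : `|normc z - normc w| <= normc (z - w).
Proof.
have := ler_dist_dist z w.
by rewrite !normcE -rmorphB lecR normc_real.
Qed.

Lemma normcX z n : normc (z ^+ n) = normc z ^+ n.
Proof. by elim: n => [|n IH]; rewrite ?expr0 ?normc1// !exprS normcM IH. Qed.

Lemma normc_sum (I : Type) (r : seq I) (P : pred I) (F : I -> R[i]) :
  normc (\sum_(i <- r | P i) F i) <= \sum_(i <- r | P i) normc (F i).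
Proof.
elim/big_rec2: _ => [|i x y _ h]; first by rewrite normc0.
by apply: le_trans (ler_normcD _ _) _; rewrite lerD2l.
Qed.

Lemma sqr_normc z : normc z ^+ 2 = complex.Re z ^+ 2 + complex.Im z ^+ 2.
Proof. by case: z => x y /=; rewrite sqr_sqrtr// addr_ge0// sqr_ge0. Qed.

Lemma ler_Re_normc z : `|complex.Re z| <= normc z.
Proof.
rewrite -(@ler_pXn2r _ 2)// ?nnegrE ?normc_ge0// sqr_normc.
by rewrite real_normK ?num_real// lerDl sqr_ge0.
Qed.

Lemma ler_Im_normc z : `|complex.Im z| <= normc z.
Proof.
rewrite -(@ler_pXn2r _ 2)// ?nnegrE ?normc_ge0// sqr_normc.
by rewrite real_normK ?num_real// lerDr sqr_ge0.
Qed.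

Lemma normc_le_ReIm z : normc z <= `|complex.Re z| + `|complex.Im z|.
Proof.
rewrite -(@ler_pXn2r _ 2)// ?nnegrE ?addr_ge0// ?normc_ge0// sqr_normc sqrrD.
rewrite !real_normK ?num_real// lerD2r lerDl.
by rewrite mulrn_wge0// mulr_ge0.
Qed.

End normc.

Section slices.
Variable R : realType.
Implicit Type F : halfplane R -> R[i].

Definition sqmod F (p : R * R) : R := normc (extend F (p.1 +i* p.2)) ^+ 2.

Lemma sqmod_ge0 F p : 0 <= sqmod F p. Proof. exact: sqr_ge0. Qed.

Lemma open_right_halfplane : open [set p : R * R | 0 < p.1].
Proof.
rewrite (_ : mkset _ = fst @^-1` `]0, +oo[%classic).
  by apply: open_comp => [p _|]; [exact: cvg_fst|exact: interval_open].
by apply/seteqP; split => p /=; rewrite in_itv/= andbT.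
Qed.

Lemma continuous_sqmod F : analytic F ->
  {in [set p | 0 < p.1], continuous (sqmod F)}.
Proof.
move=> aF p /[!inE] /= p0.
have := aF (exist _ (p.1 +i* p.2) p0); rewrite /= => /derivable1_diffP.
move=> /differentiable_continuous cF.
apply: (@continuous_comp _ _ _ (fun p => normc (extend F (p.1 +i* p.2)))
  (fun x : R => x ^+ 2)); last exact: exprn_continuous.
apply/cvgrPdist_lt => e e0.
have /cvgrPdist_lt /(_ e%:C) := cF; rewrite ltcR => /(_ e0).
move=> /(@nbhs_normP R[i] (R[i])^o _ _) [d /= d0 dF].
have [d' dE d'0] : exists2 d' : R, d = d'%:C & 0 < d'.
  move: d0; rewrite ltcE /= => /andP[/eqP d0 d1]; exists (complex.Re d) => //.
  by rewrite [LHS]complexE d0 mulr0 addr0.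
apply/(@nbhs_ballP R (R * R)%type); exists (d' / 2) => /=; first by rewrite divr_gt0.
move=> q [/= q1 q2]; have /= := dF (q.1 +i* q.2); rewrite dE normcE ltcR => H.
apply: le_lt_trans (ler_distc_dist _ _) _.
rewrite -ltcR -normcE; apply: H.
apply: le_lt_trans (normc_le_ReIm _) _ => /=.
by rewrite (splitr d'); exact: ltrD.
Qed.

Lemma measurable_sqmod F : analytic F ->
  measurable_fun ([set p | 0 < p.1] : set (measurableTypeR R * measurableTypeR R))
   (sqmod F : measurableTypeR R * measurableTypeR R -> measurableTypeR R).
Proof.
move=> aF; apply: continuous_measurable_fun_plane; last exact: continuous_sqmod.
exact: open_right_halfplane.
Qed.

End slices.

(** * Doubling measures *)

Section doubling_measure.
Variables (R : realType) (nu : {measure set (measurableTypeR R) -> \bar R}).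
Hypotheses (hreg : regular_borel nu) (hdbl : doubling nu).

Definition initial_mass x : R := fine (nu `[0, x[%classic).
Local Notation V := initial_mass.

Lemma initial_massE x : nu `[0, x[%classic = (V x)%:E.
Proof.
rewrite fineK// ge0_fin_numE//; case: hreg => hc _ _.
apply: (@le_lt_trans _ _ (nu `[0, x]%classic)); last first.
  by apply: hc; exact: segment_compact.
by apply: le_measure; rewrite ?inE//; apply: subset_itvl; rewrite bnd_simp.
Qed.

Lemma initial_mass_gt0 x : 0 < x -> 0 < V x.
Proof. by move=> x0; rewrite -lte_fin -initial_massE; exact: hdbl.1. Qed.

Lemma initial_mass_mono x y : x <= y -> V x <= V y.
Proof.
move=> xy; rewrite -lee_fin -!initial_massE.
by apply: le_measure; rewrite ?inE//; apply: subset_itvl; rewrite bnd_simp.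
Qed.

Lemma doubling_constant : exists2 D : R, 1 <= D &
  forall n t, 0 < t -> V (2 ^+ n * t) <= D ^+ n * V t.
Proof.
case: hdbl => _; set S := ereal_sup _ => Soo.
exists (Num.max 1 (fine S)); first by rewrite le_max lexx.
have H t : 0 < t -> V (2 * t) <= Num.max 1 (fine S) * V t.
  move=> t0; rewrite -ler_pdivrMr ?initial_mass_gt0//.
  have : ((V (2 * t) / V t)%:E <= S)%E.
    apply: ereal_sup_ubound; exists t => //.
    rewrite !initial_massE inver ifF ?EFinM//.
    by apply/negbTE; rewrite gt_eqF// initial_mass_gt0.
  move: Soo; case: S => [s _|//|_ //]; rewrite lee_fin => h.
  by rewrite le_max h orbT.
elim=> [|n IH] t t0; first by rewrite !expr0 !mul1r.
rewrite exprSr -mulrA; apply: le_trans (IH _ _) _; first by rewrite mulr_gt0.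
rewrite exprSr -mulrA ler_wpM2l ?H// exprn_ge0// le_max ler01//.
Qed.

(** Both inequalities are kept valid for [u < 1], by taking [n = 0] there. *)
Lemma dyadic_bracket (u : R) : 0 <= u ->
  exists n, u < 2 ^+ n.+1 /\ 2 ^+ n <= 1 + u.
Proof.
move=> u0; have ex : exists n, u < 2 ^+ n.+1.
  exists (Num.truncn u); apply: lt_trans (truncnS_gt u) _.
  by rewrite -natrX ltr_nat ltn_expl.
case: (ex_minnP ex) => -[|n] un nmin.
  by exists 0%N; split => //; rewrite expr0 lerDl.
exists n.+1; split => //; have [] := leP (2 ^+ n.+1) u => [h|h].
  by apply: le_trans h _; rewrite lerDr.
by have := nmin _ h; rewrite ltnn.
Qed.

(** The interval [0, 2 ^ n / t[ has mass at most [D ^ n * V (1 / t)], so any decay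
faster than [D ^ n] makes the dyadic pieces summable. This serves both for the weight and for the membership of test
functions in the space. *)
Lemma moment_bound : exists (p : nat) (C : R), (0 < p)%N /\ 0 < C /\
  forall (K t : R) (f : R -> R), 0 <= K -> 0 < t ->
    (forall r, 0 <= r -> 0 <= f r <= K / (1 + r * t) ^+ p) ->
  (\int[nu]_(r in `[0%R, +oo[%classic) (f r)%:E <= (K * C * V t^-1)%:E)%E.
Proof.
have [D D1 VD] := doubling_constant.
have D0 : 0 < D by apply: lt_le_trans D1.
(* With [2 * D <= 2 ^ p], the [n]-th dyadic piece is at most [2 ^ (-n)] times the
   first one. *)
pose p := (Num.truncn (2 * D)).+1.
have pD : 2 * D <= 2 ^+ p.
  apply: le_trans (ltW (truncnS_gt _)) _.
  by rewrite -natrX ler_nat ltnW// ltn_expl.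
exists p, (2 * D); split=> //; split; first exact: mulr_gt0.
move=> K t f K0 t0 hf.
pose g n (r : R) : \bar R :=
  ((K / 2 ^+ (n * p))%:E * (\1_(`[0%R, (2 ^+ n.+1 / t)%R[%classic) r)%:E)%E.
have kge n : 0 <= K / 2 ^+ (n * p) by rewrite divr_ge0// exprn_ge0.
have gge n r : (0 <= g n r)%E by rewrite /g mule_ge0// lee_fin.
apply: (@le_trans _ _ (\int[nu]_(r in `[0%R, +oo[%classic) \sum_(n <oo) g n r)%E).
  apply: ge0_integral_mono => r; rewrite /= in_itv /= andbT => r0.
    by rewrite lee_fin; case/andP: (hf _ r0).
  have [n [n1 n2]] := dyadic_bracket (mulr_ge0 r0 (ltW t0)).
  apply: (@le_trans _ _ (g n r)).
    rewrite /g indicE mem_set/=; last by rewrite in_itv/= r0 ltr_pdivlMr.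
    rewrite mule1 lee_fin; case/andP: (hf _ r0) => _ /le_trans; apply.
    rewrite ler_wpM2l// lef_pV2 ?posrE ?exprn_gt0//; last first.
      by rewrite ltr_wpDr// mulr_ge0// ltW.
    by rewrite exprM lerXn2r// nnegrE ?exprn_ge0// addr_ge0// mulr_ge0// ltW.
  apply: le_trans (nneseries_lim_ge n.+1 _) => //.
  by rewrite big_nat_recr//= leeDr// sume_ge0.
rewrite integral_nneseries//; last first.
  move=> n; apply/measurable_funTS; apply: emeasurable_funM => //.
  by apply/measurable_EFinP; exact: measurable_indic.
apply: (@le_trans _ _ (\sum_(n <oo) ((K * (2 * D) * V t^-1) / (2 ^ n.+1)%:R)%:E)%E); last first.
  apply: epsilon_trick0; rewrite !mulr_ge0// ?ltW// initial_mass_gt0//.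
  by rewrite invr_gt0.
apply: lee_nneseries => [n _ _|n _]; first by apply: integral_ge0 => r _; exact: gge.
rewrite ge0_integralZl//; first last.
- by rewrite lee_fin.
- by apply/measurable_EFinP/measurable_funTS; exact: measurable_indic.
rewrite integral_indic//.
apply: (@le_trans _ _ ((K / 2 ^+ (n * p))%:E * nu `[0%R, (2 ^+ n.+1 / t)%R[%classic)%E).
  by rewrite lee_wpmul2l ?lee_fin//; apply: le_measure; rewrite ?inE//; exact: measurableI.
rewrite initial_massE -EFinM lee_fin.
apply: (@le_trans _ _ (K / 2 ^+ (n * p) * (D ^+ n.+1 * V t^-1))).
  by rewrite ler_wpM2l// VD// invr_gt0.
have -> : K * (2 * D) * V t^-1 / (2 ^ n.+1)%:R = K * (D * V t^-1) / 2 ^+ n.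
  by rewrite natrX exprS; field; rewrite expf_neq0.
have h : D ^+ n * 2 ^+ n <= 2 ^+ (n * p).
  by rewrite -exprMn mulnC exprM lerXn2r// ?nnegrE ?exprn_ge0// mulrC// ltW// mulr_gt0.
rewrite mulrAC ler_pdivrMr ?exprn_gt0// [leRHS]mulrAC ler_pdivlMr ?exprn_gt0//.
have -> : K * (D ^+ n.+1 * V t^-1) * 2 ^+ n = K * (D * V t^-1) * (D ^+ n * 2 ^+ n).
  by rewrite exprS; ring.
rewrite ler_wpM2l// !mulr_ge0// ?ltW// initial_mass_gt0//.
by rewrite invr_gt0.
Qed.

(** The exponential kernel decays faster than any power: [(1 + u) ^ p] is at most
[p ^ p * exp u], because [1 + u / p <= exp (u / p)]. *)
Lemma weight_le_initial_mass : exists2 C : R, 0 < C &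
  forall t, 0 < t -> (weight nu t <= (C * V t^-1)%:E)%E.
Proof.
have [p [C [p0 [C0 H]]]] := moment_bound.
exists (2 * pi * (p%:R ^+ p * C)) => [|t t0].
  by rewrite !mulr_gt0// ?pi_gt0// exprn_gt0// ltr0n.
rewrite /weight -(mulrA (2 * pi)) [leRHS]EFinM lee_wpmul2l ?lee_fin ?mulr_ge0 ?pi_ge0//.
apply: H => // r r0.
rewrite expR_ge0/=.
have u0 : 0 <= r * t by rewrite mulr_ge0// ltW.
have p0' : 0 < p%:R :> R by rewrite ltr0n.
rewrite ler_pdivlMr ?exprn_gt0//; last by rewrite ltr_wpDr.
rewrite expRN mulrC ler_pdivrMr ?expR_gt0//.
apply: (@le_trans _ _ (p%:R ^+ p * expR (r * t))); last first.
  rewrite ler_wpM2l// ?exprn_ge0// ler_expR -mulrA.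
  by rewrite ler_peMl// ler1n.
have -> : expR (r * t) = expR (r * t / p%:R) ^+ p.
  by rewrite -expRM_natl; congr expR; field; rewrite gt_eqF.
rewrite -exprMn lerXn2r// ?nnegrE ?addr_ge0// ?mulr_ge0// ?expR_ge0//.
apply: le_trans (_ : p%:R * (1 + r * t / p%:R) <= _); last first.
  by rewrite ler_wpM2l// expR_ge1Dx.
rewrite mulrDr mulr1 mulrCA divff ?gt_eqF// mulr1 lerD2r ler1n//.
Qed.

End doubling_measure.

(** * Consequences of the integrability of |t ^ alpha|^2 / w *)

Section modulus_cpow.
Variable R : realType.
Implicit Types (z a : R[i]) (t : R).

Lemma normc_cexp z : normc (cexp z) = expR (complex.Re z).
Proof.
by rewrite /cexp normcM normc_real ger0_norm ?expR_ge0//= cos2Dsin2 sqrtr1 mulr1.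
Qed.

Lemma normc_cpow t a : normc (cpow t a) = expR (complex.Re a * ln t).
Proof. by rewrite /cpow normc_cexp; case: a => x y /=; rewrite mulr0 subr0. Qed.

End modulus_cpow.

Section decay.
Variables (R : realType) (nu : {measure set (measurableTypeR R) -> \bar R}).
Hypotheses (hreg : regular_borel nu) (hdbl : doubling nu).
Variables (mu : R) (hmu : 1 < mu) (alpha : R[i]).
Hypothesis halpha : (\int[@lebesgue_measure R]_(t in `]0%R, +oo[%classic)
  (((normc (cpow t alpha)) ^+ 2)%:E / weight nu t) < +oo)%E.

Local Notation V := (initial_mass nu).
Let a := complex.Re alpha.

(** Up to a constant, this bounds the mean square over a box of the function
[z |-> c ^ (- alpha) * h (c z)], for [h] in the Zen space. *)
Definition decay_rate (c : R) : R := expR (- (2 * a * ln c)) / (c * V c).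

Let mu0 : 0 < mu. Proof. exact: lt_trans hmu. Qed.

Lemma decay_rate_ge0 c : 0 < c -> 0 <= decay_rate c.
Proof.
by move=> c0; rewrite divr_ge0 ?expR_ge0// mulr_ge0 ?ltW// initial_mass_gt0.
Qed.

Lemma weight_ge0 t : (0 <= weight nu t)%E.
Proof.
by rewrite mule_ge0 ?lee_fin ?mulr_ge0 ?pi_ge0// integral_ge0.
Qed.

(** Here [t] is [1 / c] up to a factor between [1] and [mu], so [t ^ alpha] is
comparable to [c ^ (- alpha)]; and [w t] is at most [V (1 / t) <= V c] up to
a constant. *)
Lemma integrand_lower_bound : exists2 k : R, 0 < k & forall c t, 0 < c ->
  c^-1 <= t -> t < mu / c ->
  ((k * expR (- (2 * a * ln c)) / V c)%:E <=
   ((normc (cpow t alpha)) ^+ 2)%:E / weight nu t)%E.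
Proof.
have [C C0 wC] := weight_le_initial_mass hreg hdbl.
exists (expR (- (2 * `|a| * ln mu)) / C) => [|c t c0 ct tc].
  by rewrite divr_gt0// expR_gt0.
have t0 : 0 < t by apply: lt_le_trans ct; rewrite invr_gt0.
have Vc0 := initial_mass_gt0 hreg hdbl c0.
have wc : (weight nu t <= (C * V c)%:E)%E.
  apply: le_trans (wC _ t0) _; rewrite lee_fin ler_wpM2l ?(ltW C0)//.
  apply: initial_mass_mono => //.
  by rewrite -[leRHS]invrK lef_pV2 ?posrE ?invr_gt0.
have wV : (((C * V c)^-1)%:E <= (weight nu t)^-1)%E.
  move: wc (weight_ge0 t); case: (weight nu t) => [w| |]//=; rewrite !lee_fin.
  move=> wc w0; rewrite inver; case: ifPn => [_|wn0]; first by rewrite leey.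
  by rewrite lee_fin lef_pV2 ?posrE ?mulr_gt0// lt_neqAle eq_sym wn0.
have -> : expR (- (2 * `|a| * ln mu)) / C * expR (- (2 * a * ln c)) / V c =
  expR (- (2 * `|a| * ln mu) - 2 * a * ln c) * (C * V c)^-1.
  by rewrite expRD; field; rewrite !gt_eqF.
rewrite EFinM; apply: lee_pmul => //; rewrite ?lee_fin ?expR_ge0//.
  by rewrite invr_ge0 mulr_ge0// ltW.
rewrite normc_cpow -expRM_natl ler_expR -/a.
have l1 : 0 <= ln t + ln c.
  rewrite -lnM ?posrE// ln_ge0//.
  by rewrite -(ler_pM2r c0) mulVf ?gt_eqF// in ct.
have l2 : ln t + ln c <= ln mu.
  by rewrite -lnM ?posrE// ler_ln ?posrE ?mulr_gt0// -ler_pdivlMr// ltW.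
have : - (`|a| * ln mu) <= a * (ln t + ln c).
  apply: le_trans (_ : - (`|a| * (ln t + ln c)) <= _).
    by rewrite lerN2 ler_wpM2l.
  by rewrite -mulNr ler_wpM2r// lerNl ler_normr lexx orbT.
by move=> h; lra.
Qed.

(** The intervals have length proportional to [1 / c], so [integrand_lower_bound]
bounds the sum of the rates by the integral: the rates are therefore terms of a
convergent series. *)
Lemma decay_along (c : nat -> R) : (forall n, 0 < c n) ->
  (forall n m t, n != m -> (c n)^-1 <= t < mu / c n ->
     (c m)^-1 <= t < mu / c m -> False) ->
  decay_rate (c n) @[n --> \oo] --> 0.
Proof.
move=> c0 disj; have [k k0 kle] := integrand_lower_bound.
pose f (t : R) : \bar R := (((normc (cpow t alpha)) ^+ 2)%:E / weight nu t)%E.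
have fin : (\int[@lebesgue_measure R]_(t in `]0%R, +oo[%classic) f t < +oo)%E.
  exact: halpha.
apply: cvg_series_cvg_0; apply: nondecreasing_is_cvgn.
  apply: nondecreasing_series => n _ _; exact: decay_rate_ge0.
have intf0 : (0 <= \int[@lebesgue_measure R]_(t in `]0%R, +oo[%classic) f t)%E.
  apply: integral_ge0 => t _; rewrite mule_ge0 ?lee_fin ?sqr_ge0//.
  by rewrite inve_ge0 weight_ge0.
pose K := fine (\int[@lebesgue_measure R]_(t in `]0%R, +oo[%classic) f t).
have mu1 : 0 < mu - 1 by rewrite subr_gt0.
exists (K / (k * (mu - 1))) => _ [N _ <-]; rewrite ler_pdivlMr ?mulr_gt0//.
rewrite -lee_fin fineK ?ge0_fin_numE//.
pose I n : set R := `[(c n)^-1, mu / c n[%classic.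
pose h n := k * expR (- (2 * a * ln (c n))) / V (c n).
have h0 n : 0 <= h n.
  by rewrite divr_ge0 ?mulr_ge0 ?(ltW k0) ?expR_ge0 ?ltW ?initial_mass_gt0.
have mI n : measurable_fun (`]0, +oo[%classic : set (measurableTypeR R))
    (fun t : measurableTypeR R => (\1_(I n) t)%:E).
  apply/measurable_EFinP/measurable_funTS; apply: measurable_indic.
  exact: measurable_itv.
apply: (@le_trans _ _ (\int[@lebesgue_measure R]_(t in `]0%R, +oo[%classic)
    (\sum_(0 <= n < N) (h n)%:E * (\1_(I n) t)%:E))%E); last first.
  apply: ge0_integral_mono => t; rewrite /= in_itv/= andbT => t0.
    by apply: sume_ge0 => n _; rewrite mule_ge0 ?lee_fin.
  have [[n [nN tn]]|no] := pselect (exists n, (n < N)%N /\ I n t).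
    rewrite big_mkord (bigD1 (Ordinal nN))//= big1 ?adde0.
      rewrite indicE mem_set// mule1.
      by move: tn; rewrite /I/= in_itv/= => /andP[] *; exact: kle.
    move=> i /eqP ni; rewrite indicE memNset ?mule0//.
    rewrite /I /= in_itv/= => ti.
    have tn' : (c n)^-1 <= t < mu / c n by move: tn; rewrite /I/= in_itv/=.
    have in' : (i : nat) != n by apply/eqP => E; apply: ni; exact: val_inj.
    exact: (disj i n t in' ti tn').
  rewrite big_mkord big1 => [|i _].
    by rewrite mule_ge0 ?lee_fin ?sqr_ge0// inve_ge0 weight_ge0.
  by rewrite indicE memNset ?mule0// => ti; apply: no; exists i.
rewrite ge0_integral_sum//; last 2 first.
  by move=> n; apply: emeasurable_funM; [exact: measurable_cst|exact: mI].
  by move=> n t _; rewrite mule_ge0 ?lee_fin.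
rewrite /series/= mulr_suml -sumEFin; apply: lee_sum => n _.
rewrite ge0_integralZl//; last by rewrite lee_fin.
rewrite integral_indic; [|exact: measurable_itv|exact: measurable_itv].
rewrite setIidl; last first.
  move=> t; rewrite /I/= !in_itv/= andbT => /andP[+ _]; apply: lt_le_trans.
  by rewrite invr_gt0.
rewrite /I /= lebesgue_measure_itv/= lte_fin ltr_pdivlMr// mulVf ?gt_eqF// hmu.
rewrite -EFinD -EFinM lee_fin /h /decay_rate.
rewrite le_eqVlt; apply/orP; left; apply/eqP.
have Vn : V (c n) != 0 by rewrite gt_eqF// initial_mass_gt0.
by field; rewrite Vn gt_eqF.
Qed.

Lemma decay_rate_pow : decay_rate (mu ^+ n) @[n --> \oo] --> 0.
Proof.
apply: decay_along => [n|n m t]; first exact: exprn_gt0.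
have E k : ((mu ^+ k)^-1 <= t < mu / mu ^+ k) = (1 <= t * mu ^+ k < mu).
  have e0 := exprn_gt0 k mu0; rewrite ltr_pdivlMr//; congr (_ && _).
  by rewrite -[LHS](ler_pM2r e0) mulVf ?gt_eqF.
rewrite !E; wlog nm : n m / (n < m)%N => [hw|_ /andP[n1 _] /andP[_]].
  rewrite neq_ltn => /orP[] nm h1 h2; first by apply: (hw n m) => //; rewrite ltn_eqF.
  by apply: (hw m n) => //; rewrite ltn_eqF.
rewrite -(subnKC nm) exprD exprSr !mulrA ltNge => /negP; apply.
rewrite -[leLHS]mulr1; apply: ler_pM; rewrite ?(ltW mu0)//.
  by rewrite ler_peMl// ltW.
by rewrite exprn_ege1// ltW.
Qed.

Lemma decay_rate_pow_inv : decay_rate (mu ^- n) @[n --> \oo] --> 0.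
Proof.
apply: decay_along => [n|n m t]; first by rewrite invr_gt0 exprn_gt0.
rewrite !invrK -!exprS; wlog nm : n m / (n < m)%N => [hw|_ /andP[_ n1] /andP[m1 _]].
  rewrite neq_ltn => /orP[] nm h1 h2; first by apply: (hw n m) => //; rewrite ltn_eqF.
  by apply: (hw m n) => //; rewrite ltn_eqF.
have := lt_le_trans (le_lt_trans m1 n1) (_ : mu ^+ n.+1 <= mu ^+ m).
by rewrite ltxx ler_weXn2l ?ltW// => /(_ isT).
Qed.

Lemma decay_rate_expn n : decay_rate (mu ^+ n) =
  (normc (cpow mu alpha))^-1 ^+ (n * 2) / (mu ^+ n * V (mu ^+ n)).
Proof.
rewrite normc_cpow -/a /decay_rate lnXn// -expRN -expRM_natl; congr (expR _ / _).
by rewrite natrM -mulr_natl; ring.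
Qed.

Lemma decay_rate_expNn n : decay_rate (mu ^- n) =
  normc (cpow mu alpha) ^+ (n * 2) / (mu ^- n * V (mu ^- n)).
Proof.
rewrite normc_cpow -/a /decay_rate lnV ?posrE ?exprn_gt0// lnXn// -expRM_natl.
by congr (expR _ / _); rewrite natrM -mulr_natl; ring.
Qed.

(** For [c = mu ^ (-n)] the rate is [|lam| ^ (2 n) / (c * V c)] and [c * V c <= V 1]:
it cannot vanish if [1 <= |lam|]. *)
Lemma normc_cpow_lt1 : normc (cpow mu alpha) < 1.
Proof.
have [//|l1] := ltP.
have /cvgrPdist_lt/(_ (V 1)^-1) := decay_rate_pow_inv.
rewrite invr_gt0 initial_mass_gt0// => /(_ isT)[N _ /(_ N (leqnn N))].
rewrite sub0r normrN /=; have mN : 0 < mu ^- N by rewrite invr_gt0 exprn_gt0.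
rewrite ger0_norm ?decay_rate_ge0// decay_rate_expNn ltNge => /negP[].
have VN := initial_mass_gt0 hreg hdbl mN.
rewrite ler_pdivlMr ?mulr_gt0//.
apply: le_trans (_ : 1 <= _); last by rewrite exprn_ege1.
rewrite ler_pdivrMl ?initial_mass_gt0// mulr1.
rewrite -[leRHS]mul1r; apply: ler_pM; rewrite ?(ltW mN) ?(ltW VN)//.
  by rewrite invf_le1 ?exprn_gt0// exprn_ege1// ltW.
by apply: initial_mass_mono => //; rewrite invf_le1 ?exprn_gt0// exprn_ege1// ltW.
Qed.

End decay.

(** * Area bounds in the Zen space *)

Lemma indic_itvE (R : realType) (i : interval R) (x : R) :
  \1_([set` i]) x = (x \in i)%:R :> R.
Proof. by rewrite indicE; congr ((_ : bool)%:R); apply/idP/idP; rewrite inE. Qed.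

(** Repackages a measure so that Tonelli's theorem, which is stated for bundled
sigma-finite measures, applies to it. *)
Lemma sigma_finite_measure_of d (T : measurableType d) (R : realType)
    (m : {measure set T -> \bar R}) : sigma_finite setT m ->
  exists m' : {sigma_finite_measure set T -> \bar R},
    (m' : set T -> \bar R) = m.
Proof.
case: m => m cm h; pose M := Measure.Pack cm.
pose B := Measure_isSigmaFinite.Build d T R M h.
pose m' : {sigma_finite_measure set T -> \bar R} := HB.pack m cm B.
by exists m'.
Qed.

Lemma regular_borel_sigma_finite (R : realType)
    (nu : {measure set (measurableTypeR R) -> \bar R}) :
  regular_borel nu -> sigma_finite setT nu.
Proof.
case=> hc _ _; exists (fun n : nat => `[- n%:R, n%:R]%classic) => [|n].
  apply/esym; rewrite -subTset => x _; exists (Num.truncn `|x|).+1 => //=.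
  by rewrite in_itv/= -ler_norml ltW// truncnS_gt.
by split; [exact: measurable_itv|apply: hc; exact: segment_compact].
Qed.

Lemma tonelli_sigma_finite d1 d2 (T1 : measurableType d1)
    (T2 : measurableType d2) (R : realType)
    (m1 : {measure set T1 -> \bar R}) (m2 : {sigma_finite_measure set T2 -> \bar R})
    (f : T1 * T2 -> \bar R) : sigma_finite setT m1 ->
  measurable_fun setT f -> (forall p, 0 <= f p)%E ->
  (\int[(m1 \x m2)%E]_p f p = \int[m1]_x \int[m2]_y f (x, y))%E /\
  (\int[m1]_x \int[m2]_y f (x, y) = \int[m2]_y \int[m1]_x f (x, y))%E.
Proof.
move=> /sigma_finite_measure_of [m1' <-] mf f0; split.
  exact: fubini_tonelli1.
exact: fubini_tonelli.
Qed.

Section area_bound.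
Variables (R : realType) (nu : {measure set (measurableTypeR R) -> \bar R}).
Hypotheses (hreg : regular_borel nu) (hdbl : doubling nu).
Variables (F : halfplane R -> R[i]) (M : R).
Hypothesis aF : analytic F.
Hypothesis FM : forall e, 0 < e ->
  (\int[(nu \x (@lebesgue_measure R))%E]_(p in [set p | (0 <= p.1)%R])
     (sqmod F (p.1 + e, p.2))%:E <= M%:E)%E.
Local Notation leb := (@lebesgue_measure R).
Local Notation V := (initial_mass nu).
Let T := measurableTypeR R.

Let D0 : set (T * T) := [set p : R * R | 0 < p.1].

Let f : T * T -> \bar R := (fun p : T * T => (sqmod F p)%:E) \_ D0.

Let f0 p : (0 <= f p)%E.
Proof. by rewrite /f /patch; case: ifP => _ //; rewrite lee_fin sqmod_ge0. Qed.

Let fE x y : 0 < x -> f (x, y) = (sqmod F (x, y))%:E.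
Proof. by move=> x0; rewrite /f patchT// inE. Qed.

Let measurable_Re_gt0 : measurable D0.
Proof. by apply: open_measurable_plane; exact: open_right_halfplane. Qed.

Let mf : measurable_fun setT f.
Proof.
apply: (measurable_restrictT _ measurable_Re_gt0).1.
by apply/measurable_EFinP; exact: measurable_sqmod.
Qed.

Let mf2 x : measurable_fun setT (fun y : T => f (x, y)).
Proof. exact: measurable_fun_pair2. Qed.

Let G (x : R) : \bar R := (\int[leb]_y f (x, y))%E.

Let G0 x : (0 <= G x)%E. Proof. exact: integral_ge0. Qed.

Let mG : measurable_fun setT (G : T -> \bar R).
Proof. exact: measurable_fun_fubini_tonelli_F. Qed.

Let vertical_mean (e : R) : 0 < e ->
  (\int[nu]_r ((\1_(`[0%R, +oo[%classic) r)%:E * G (r + e)%R) <= M%:E)%E.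
Proof.
move=> e0; apply: le_trans (FM e0).
rewrite [leRHS]integral_mkcond.
pose g (p : T * T) := ((\1_(`[0%R, +oo[%classic) p.1)%:E * f (p.1 + e, p.2)%R)%E.
have mg : measurable_fun setT g.
  apply: emeasurable_funM.
    apply/measurable_EFinP.
    apply: (measurableT_comp (f := \1_(`[0%R, +oo[%classic) : T -> T)) => //;
      exact: measurable_indic.
  apply: (measurableT_comp mf); apply: measurable_fun_pair => //=.
  by apply: measurable_funD.
have g0 p : (0 <= g p)%E by rewrite mule_ge0// lee_fin.
rewrite (eq_integral g); last first.
  move=> p _; rewrite /g /patch indic_itvE in_itv/= andbT.
  case: ifPn => [/[!inE]/= p1|/negP p1]; first by rewrite p1 mul1e fE// ltr_wpDl.
  suff /negbTE -> : ~~ (0 <= p.1 :> R) by rewrite mul0e.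
  by apply/negP => p1'; apply: p1; rewrite inE.
rewrite (tonelli_sigma_finite leb (regular_borel_sigma_finite hreg) mg g0).1.
apply: ge0_integral_mono => r _; first by rewrite mule_ge0// lee_fin.
by rewrite /g /= ge0_integralZl// lee_fin.
Qed.


Let M0 : 0 <= M.
Proof.
rewrite -lee_fin; apply: le_trans (FM ltr01); apply: integral_ge0 => p _.
by rewrite lee_fin sqmod_ge0.
Qed.

(** [vertical_mean] is averaged over the shifts [e] in ]0, B]. For every
[0 <= r < A], the translate by [r] of ]0, B] contains the interval from [A] to
[B], so each [r] of this range contributes at least the integral of [G] there. *)
Let strip_bound (A B : R) : 0 < A -> A < B ->
  ((V A)%:E * \int[leb]_u ((\1_(`[A, B]%classic) u)%:E * G u) <= (B * M)%:E)%E.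
Proof.
move=> A0 AB; have B0 : 0 < B by exact: lt_trans AB.
pose H (p : T * T) : \bar R := ((\1_(`[0%R, A[%classic) p.1)%:E *
  ((\1_(`]0%R, B]%classic) p.2)%:E * G (p.1 + p.2)%R))%E.
have mH : measurable_fun setT H.
  apply: emeasurable_funM.
    apply/measurable_EFinP.
    apply: (measurableT_comp (f := \1_(`[0%R, A[%classic) : T -> T)) => //;
      exact: measurable_indic.
  apply: emeasurable_funM.
    apply/measurable_EFinP.
    apply: (measurableT_comp (f := \1_(`]0%R, B]%classic) : T -> T)) => //;
      exact: measurable_indic.
  by apply: (measurableT_comp mG); exact: measurable_funD.
have H0 p : (0 <= H p)%E by rewrite !mule_ge0// lee_fin.
have mGI : measurable_fun setT (fun u : T => (\1_(`[A, B]%classic) u)%:E * G u)%E.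
  by apply: emeasurable_funM => //; apply/measurable_EFinP; exact: measurable_indic.
have GI0 u : (0 <= (\1_(`[A, B]%classic) u)%:E * G u)%E by rewrite mule_ge0// lee_fin.
apply: (@le_trans _ _ (\int[nu]_r \int[leb]_e H (r, e))%E).
  rewrite -initial_massE// -[X in nu X]setIT -integral_indic//.
  rewrite muleC -ge0_integralZl//; last 2 first.
  - by apply/measurable_EFinP; exact: measurable_indic.
  - exact: integral_ge0.
  apply: ge0_integral_mono => r _.
    by rewrite mule_ge0 ?lee_fin// integral_ge0.
  rewrite /H/= muleC indic_itvE in_itv/=.
  case: (boolP (0 <= r < A)) => [/andP[r0 rA]|_]; last first.
    by rewrite mul0e integral_ge0// => e _; rewrite mul0e.
  rewrite mul1e (ge0_integral_affine r ltr01 mGI GI0) mul1e.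
  apply: ge0_integral_mono => e _ //; rewrite mul1r mul1e !indic_itvE !in_itv/=.
  case: (boolP (A <= e + r <= B)) => [/andP[h1 h2]|_]; last first.
    by rewrite mul0e mule_ge0// lee_fin.
  have -> : 0 < e <= B by apply/andP; split; lra.
  by rewrite addrC.
rewrite (tonelli_sigma_finite leb (regular_borel_sigma_finite hreg) mH H0).2.
apply: (@le_trans _ _ (\int[leb]_e (M%:E * (\1_(`]0%R, B]%classic) e)%:E))%E).
  apply: ge0_integral_mono => e _; first exact: integral_ge0.
  rewrite /H/= indic_itvE in_itv/=.
  case: (boolP (0 < e <= B)) => [/andP[e0 eB]|_]; last first.
    by under eq_integral do rewrite mul0e mule0; rewrite integral0 mule0.
  rewrite mule1; apply: le_trans (vertical_mean e0).
  apply: ge0_integral_mono => r _; first by rewrite mul1e mule_ge0// lee_fin.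
  rewrite mul1e; apply: lee_wpmul2r => //; rewrite lee_fin !indic_itvE !in_itv/= andbT.
  by case: (0 <= r) => //=; rewrite lern1 leq_b1.
rewrite ge0_integralZl//; last first.
  by apply/measurable_EFinP; exact: measurable_indic.
rewrite integral_indic// setIT /= lebesgue_measure_itv/= lte_fin B0 -EFinM lee_fin.
by rewrite oppr0 addr0 mulrC.
Qed.

(** Scaled by [c], the box lies in the strip of abscissae between [c * x1] and
[c * x2]; the change of variables contributes a factor [c ^ (-2)]. *)
Lemma box_area_bound (c x1 x2 y1 y2 : R) : 0 < c -> 0 < x1 -> x1 < x2 ->
  (\int[leb]_(x in `[x1, x2]%classic) \int[leb]_(y in `[y1, y2]%classic)
     (sqmod F (c * x, c * y))%:E <= (x2 * M / (c * V (c * x1)))%:E)%E.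
Proof.
move=> c0 x10 x12.
have cx1 : 0 < c * x1 by exact: mulr_gt0.
have cx12 : c * x1 < c * x2 by rewrite ltr_pM2l.
have V0 := initial_mass_gt0 hreg hdbl cx1.
have := strip_bound cx1 cx12.
set I := (X in (_ * X)%E) => hI.
apply: (@le_trans _ _ ((c^-1 * c^-1)%:E * I)%E); last first.
  have {hI} : (I <= ((V (c * x1))^-1 * (c * x2 * M))%:E)%E.
    by rewrite EFinM lee_pdivlMl.
  move=> hI; apply: le_trans (lee_wpmul2l _ hI) _.
    by rewrite lee_fin mulr_ge0// invr_ge0 ltW.
  rewrite -EFinM lee_fin le_eqVlt; apply/orP; left; apply/eqP.
  by field; rewrite !gt_eqF.
have mGI : measurable_fun setT
    (fun u : T => (\1_(`[c * x1, c * x2]%classic) u)%:E * G u)%E.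
  by apply: emeasurable_funM => //; apply/measurable_EFinP; exact: measurable_indic.
have GI0 (u : R) : (0 <= (\1_(`[c * x1, c * x2]%classic) u)%:E * G u)%E.
  by rewrite mule_ge0// lee_fin.
rewrite /I (ge0_integral_affine 0 c0 mGI GI0) muleA -EFinM -mulrA mulVf ?gt_eqF//.
rewrite mulr1 -ge0_integralZl//; first last.
- by rewrite lee_fin invr_ge0 ltW.
- apply: (measurableT_comp mGI).
  by apply: measurable_funD => //; exact: measurable_funM.
rewrite [leLHS]integral_mkcond; apply: ge0_integral_mono => x _.
  rewrite /patch; case: ifP => // _; apply: integral_ge0 => y _.
  by rewrite lee_fin sqmod_ge0.
rewrite addr0 indic_itvE in_itv/= !ler_pM2l// /patch.
case: ifPn => [/[!inE]/=|_]; last first.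
  by rewrite mule_ge0 ?lee_fin ?invr_ge0 ?(ltW c0)// mule_ge0// lee_fin.
rewrite in_itv/= => x12'; rewrite x12' mul1e /G.
have cx0 : 0 < c * x by case/andP: x12' => h _; rewrite mulr_gt0// (lt_le_trans x10).
rewrite (ge0_integral_affine 0 c0 (mf2 (c * x)) (fun y => f0 (c * x, y))).
rewrite muleA -EFinM mulVf ?gt_eqF// mul1e [leLHS]integral_mkcond.
apply: ge0_integral_mono => y _.
  by rewrite /patch; case: ifP => // _; rewrite lee_fin sqmod_ge0.
rewrite addr0 fE// /patch; case: ifP => // _; rewrite lee_fin sqmod_ge0//.
Qed.


End area_bound.

(** * Functions with a pole belong to the Zen space *)

Section zen_norm_bound.
Variables (R : realType) (nu : {measure set (measurableTypeR R) -> \bar R}).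
Implicit Type F : halfplane R -> R[i].

Let vertical_int F (e : R) : \bar R :=
  (\int[(nu \x (@lebesgue_measure R))%E]_(p in [set p | (0 <= p.1)%R])
     (sqmod F (p.1 + e, p.2)%R)%:E)%E.

Lemma zen_norm_ltyP F : (zen_norm nu F < +oo)%E <->
  exists M : R, forall e, 0 < e -> (vertical_int F e <= M%:E)%E.
Proof.
rewrite /zen_norm; set S := ereal_sup _.
have SE e : 0 < e -> (vertical_int F e <= S)%E.
  by move=> e0; apply: ereal_sup_ubound; exists e.
have S0 : (0 <= S)%E.
  by apply: le_trans (SE 1 ltr01); apply: integral_ge0 => p _; rewrite lee_fin sqmod_ge0.
have sqrteP (X : \bar R) : (0 <= X)%E -> (sqrte X < +oo)%E = (X < +oo)%E.
  by case: X => [r| |] //= _; rewrite !ltey.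
rewrite sqrteP//; split => [h|[M hM]].
  by exists (fine S) => e e0; rewrite fineK ?SE// ge0_fin_numE.
by apply: (@le_lt_trans _ _ M%:E); [apply: ge_ereal_sup => _ [e e0 <-]; exact: hM|exact: ltey].
Qed.

End zen_norm_bound.

Section pole_functions.
Variables (R : realType) (nu : {measure set (measurableTypeR R) -> \bar R}).
Hypotheses (hreg : regular_borel nu) (hdbl : doubling nu).

Definition pole_function (w : R[i]) (m : nat) (s : halfplane R) : R[i] :=
  (val s + w)^-1 ^+ m.

Lemma extend_pole_function w m z : 0 < complex.Re z ->
  extend (pole_function w m) z = (z + w)^-1 ^+ m.
Proof. by move=> z0; rewrite /extend insubT. Qed.

Lemma analytic_pole_function w m : 0 < complex.Re w -> analytic (pole_function w m).
Proof.
move=> w0 s.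
apply: (@near_eq_derivable R[i] (R[i])^o (R[i])^o
  ((fun z : (R[i])^o => (z + w)^-1) ^+ m)).
- have s0 : 0 < (complex.Re (val s))%:C by rewrite ltcR; exact: (valP s).
  apply/(@nbhs_normP R[i] (R[i])^o); exists (complex.Re (val s))%:C => //= z.
  rewrite /ball_ /= ltcR => h; rewrite exprfctE extend_pole_function//.
  have := le_lt_trans (ler_Re_normc _) h; rewrite raddfB /= => /ltr_normlW.
  by rewrite ltrBlDr ltrDl.
- apply: derivableX; apply: derivableV.
    rewrite -normr_gt0 normcE ltcR; apply: lt_le_trans (ler_Re_normc _).
    by rewrite raddfD /= gtr0_norm addr_gt0// (valP s).
  by apply: derivableD; [exact: derivable_id|exact: derivable_cst].
Qed.

Lemma integral_oneDsqr_affine (a b : R) : 0 < a ->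
  (\int[@lebesgue_measure R]_y ((oneDsqr (a * y + b))^-1)%:E = (pi / a)%:E)%E.
Proof.
move=> a0.
have mf : measurable_fun setT
    (fun y : measurableTypeR R => ((oneDsqr (y : R))^-1)%:E : \bar R).
  apply/measurable_EFinP; apply: continuous_measurable_fun.
  exact: continuous_oneDsqrV.
have f0 (y : R) : (0 <= ((oneDsqr y)^-1)%:E)%E.
  by rewrite lee_fin invr_ge0 (le_trans ler01)// oneDsqr_ge1.
have := ge0_integral_affine b a0 mf f0.
rewrite (ge0_symfun_integralT (f := fun y => (oneDsqr y)^-1)); last 3 first.
- by move=> y; rewrite -lee_fin.
- exact: continuous_oneDsqrV.
- by move=> y /=; rewrite /oneDsqr sqrrN.
rewrite -set_itvcy integral0y_oneDsqr -EFinM mulrCA divff ?mulr1// => H.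
by rewrite mulrC EFinM H muleA -EFinM mulVf ?gt_eqF// mul1e.
Qed.

(** The square of [|x + iy + w|] bounds both [(x + Re w)^2], whose power [k] controls
the integral along [nu], and [(Re w)^2 + (y + Im w)^2], which makes the integral
in [y] converge. *)
Lemma normc_pole_function (w : R[i]) k (x y : R) : 0 <= x -> 0 < complex.Re w ->
  normc (((x +i* y) + w)^-1 ^+ k.+1) ^+ 2 <=
  ((Num.min 1 (complex.Re w) * (1 + x)) ^+ (2 * k))^-1 *
  ((complex.Re w) ^+ 2 *
    oneDsqr ((complex.Re w)^-1 * y + complex.Im w / complex.Re w))^-1.
Proof.
move=> x0 w0; set e := complex.Re w; set v := complex.Im w.
rewrite normcX normcV exprAC exprVn sqr_normc !raddfD /= -/e -/v.
set Q := _ + _.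
have t0 : 0 < Num.min 1 e * (1 + x) by rewrite mulr_gt0 ?lt_min ?ltr01// ltr_wpDr.
have q1 : (Num.min 1 e * (1 + x)) ^+ 2 <= Q.
  rewrite /Q; apply: le_trans (_ : (x + e) ^+ 2 <= _); last by rewrite lerDl sqr_ge0.
  rewrite lerXn2r ?nnegrE ?(ltW t0) ?addr_ge0 ?(ltW w0)//.
  rewrite mulrDr mulr1 addrC lerD// ?ge_min ?lexx ?orbT//.
  by rewrite ler_piMl// ge_min lexx.
have q2 : e ^+ 2 * oneDsqr (e^-1 * y + v / e) <= Q.
  have -> : e ^+ 2 * oneDsqr (e^-1 * y + v / e) = e ^+ 2 + (y + v) ^+ 2.
    by rewrite /oneDsqr; field; rewrite gt_eqF.
  by rewrite lerD2r lerXn2r ?nnegrE ?addr_ge0 ?(ltW w0)// lerDr.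
have p2 : 0 < e ^+ 2 * oneDsqr (e^-1 * y + v / e).
  by rewrite mulr_gt0 ?exprn_gt0// (lt_le_trans ltr01)// oneDsqr_ge1.
have Q0 : 0 < Q by exact: lt_le_trans q2.
have Qi : 0 <= Q^-1 by rewrite invr_ge0 ltW.
rewrite exprSr ler_pM ?exprn_ge0//.
  rewrite exprVn lef_pV2 ?posrE ?exprn_gt0// exprM lerXn2r ?nnegrE ?(ltW Q0)//.
  by rewrite exprn_ge0// ltW.
by rewrite lef_pV2.
Qed.

Lemma pole_function_zen : exists p : nat, forall (w : R[i]) m,
  0 < complex.Re w -> (p < m)%N -> zen_space nu (pole_function w m).
Proof.
have [p [C [p0 [C0 H]]]] := moment_bound hreg hdbl.
exists p => w [//|k] w0 pk; split; first exact: analytic_pole_function.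
set e := complex.Re w in w0; pose v := complex.Im w.
have t0 : 0 < Num.min 1 e by rewrite lt_min ltr01.
have [K [K0 KE]] : exists K, 0 <= K /\ K = (Num.min 1 e ^+ (2 * k))^-1 * e ^- 2.
  by eexists; split; [|reflexivity]; rewrite mulr_ge0// invr_ge0 exprn_ge0// ltW.
pose T := measurableTypeR R.
pose g (x : R) : R := K * (\1_(`[0%R, +oo[%classic) x * (1 + `|x|) ^- p).
pose h (y : R) : R := (oneDsqr (e^-1 * y + v / e))^-1.
have g0 x : 0 <= g x by rewrite !mulr_ge0// invr_ge0 exprn_ge0// addr_ge0.
have h0 y : 0 <= h y by rewrite invr_ge0 (le_trans ler01)// oneDsqr_ge1.
have mg : measurable_fun setT (g : T -> T).
  apply: measurable_funM => //; apply: measurable_funM.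
    exact: measurable_indic.
  apply: continuous_measurable_fun => x; apply: cvgV.
    by rewrite gt_eqF// exprn_gt0// ltr_pwDl.
  apply: (continuous_comp (f := fun x : R => 1 + `|x|) (g := fun x => x ^+ p));
    last exact: exprn_continuous.
  by apply: cvgD; [exact: cvg_cst|exact: norm_continuous].
have mh : measurable_fun setT (h : T -> T).
  apply: (measurableT_comp (f := (fun x => (oneDsqr x)^-1) : T -> T)).
    apply: continuous_measurable_fun; exact: continuous_oneDsqrV.
  by apply: measurable_funD => //; exact: measurable_funM.
pose G (q : T * T) : \bar R := ((g q.1)%:E * (h q.2)%:E)%E.
have mG : measurable_fun setT G.
  by apply: emeasurable_funM; apply/measurable_EFinP; exact: measurableT_comp.
have G0 q : (0 <= G q)%E by rewrite mule_ge0 ?lee_fin.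
apply/(zen_norm_ltyP nu).
exists (K * (pi * e) * C * initial_mass nu 1^-1) => d d0.
apply: (@le_trans _ _ (\int[(nu \x (@lebesgue_measure R))%E]_q G q)%E).
  rewrite [leLHS]integral_mkcond; apply: ge0_integral_mono => -[x y] _.
    by rewrite /patch; case: ifP => // _; rewrite lee_fin sqmod_ge0.
  rewrite /patch; case: ifPn => [/[!inE]/= x0|_]; last exact: G0.
  rewrite /G /sqmod /= -EFinM lee_fin extend_pole_function/=; last exact: ltr_wpDl.
  have x1 : 0 < 1 + x by rewrite ltr_wpDr.
  apply: le_trans (normc_pole_function _ _ _ w0) _; first by rewrite addr_ge0// ltW.
  rewrite -/e -/v /g /h indic_itvE in_itv/= x0 mul1r ger0_norm// KE.
  set O := oneDsqr _; have O0 : 0 < O by apply: lt_le_trans ltr01 (oneDsqr_ge1 _).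
  have -> : (Num.min 1 e ^+ (2 * k))^-1 * e ^- 2 * (1 + x) ^- p * O^-1 =
      (Num.min 1 e ^+ (2 * k) * (1 + x) ^+ p)^-1 * (e ^+ 2 * O)^-1.
    by rewrite !invfM; ring.
  have m0 : 0 < Num.min 1 e * (1 + (x + d)) by rewrite mulr_gt0// addr_gt0// ltr_wpDl.
  rewrite ler_wpM2r ?invr_ge0 ?mulr_ge0 ?exprn_ge0 ?(ltW O0) ?(ltW w0)//.
  rewrite lef_pV2 ?posrE ?exprn_gt0// ?mulr_gt0 ?exprn_gt0//.
  rewrite exprMn ler_wpM2l ?exprn_ge0 ?(ltW t0)//.
  apply: le_trans (_ : (1 + x) ^+ (2 * k) <= _).
    by rewrite ler_weXn2l ?lerDl//; rewrite mul2n -addnn (leq_trans (pk : (p <= k)%N))// leq_addr.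
  by rewrite lerXn2r ?nnegrE ?addr_ge0 ?(ltW x1) ?(ltW d0)// lerD2l lerDl ltW.
rewrite (tonelli_sigma_finite _ (regular_borel_sigma_finite hreg) mG G0).1.
apply: (@le_trans _ _ (\int[nu]_(x in `[0%R, +oo[%classic) (g x * (pi * e))%:E)%E).
  rewrite [leRHS]integral_mkcond; apply: ge0_integral_mono => x _.
    exact: integral_ge0.
  rewrite /G /= ge0_integralZl//; last 2 first.
  - by move=> y _; rewrite lee_fin.
  - by rewrite lee_fin.
  rewrite integral_oneDsqr_affine ?invr_gt0// invrK -EFinM /patch.
  case: ifPn => // xn; rewrite /g indicE (negbTE xn) mul0r mulr0 mul0r lexx//.
  by apply/measurable_EFinP; exact: mh.
apply: (H (K * (pi * e)) 1 (fun x => g x * (pi * e))) => // [|x x0].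
  by rewrite !mulr_ge0// ?pi_ge0// ltW.
rewrite mulr_ge0 ?g0 ?mulr_ge0 ?pi_ge0 ?(ltW w0)//= mulr1 /g indic_itvE in_itv/= x0.
by rewrite mul1r ger0_norm// mulrAC.
Qed.

End pole_functions.

(** * Two-sided sums *)

Lemma scale_complexE (R : realType) (c : R) (z : R[i]) :
  c%:C * z = (c * complex.Re z) +i* (c * complex.Im z).
Proof. by case: z => x y; apply/eqP; rewrite eq_complex /= !mul0r subr0 addr0 !eqxx. Qed.

Section two_sided_sum.
Variables (R : realType) (mu : R) (lam : R[i]).
Hypotheses (mu1 : 1 < mu) (lam0 : lam != 0).
Let mu0 : 0 < mu. Proof. exact: lt_trans mu1. Qed.

(** The terms [k = i] and [k = - i - 1] of the sum over the integers [k] of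
[lam ^ (-k-1) * g (mu ^ k * z)] are grouped together. *)
Definition two_sided_sum (g : R[i] -> R[i]) (n : nat) (z : R[i]) : R[i] :=
  \sum_(i < n) (lam ^- i.+1 * g ((mu ^+ i)%:C * z) +
                lam ^+ i * g ((mu ^- i.+1)%:C * z)).

(** The positive and the negative halves telescope separately, and their common
end term [h z] cancels. *)
Lemma two_sided_sum_telescope (g h : R[i] -> R[i]) (n : nat) (z : R[i]) :
  (forall c : R, 0 < c -> g (c%:C * z) = h ((mu * c)%:C * z) - lam * h (c%:C * z)) ->
  two_sided_sum g n z =
  lam ^- n * h ((mu ^+ n)%:C * z) - lam ^+ n * h ((mu ^- n)%:C * z).
Proof.
move=> gh; rewrite /two_sided_sum; elim: n => [|n IH].
  by rewrite big_ord0 !expr0 !invr1 !mul1r subrr.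
rewrite big_ord_recr/= IH !gh ?invr_gt0 ?exprn_gt0// -exprS.
have -> : mu * mu ^- n.+1 = mu ^- n.
  by rewrite exprS invfM mulrA divff ?mul1r// gt_eqF.
set a := h _; set b := h _; set c := h _; set d := h _.
by rewrite !exprS; field; rewrite lam0 expf_neq0.
Qed.

Lemma two_sided_sum_linear (N : nat) (d : 'I_N -> R[i]) (g : 'I_N -> R[i] -> R[i])
    n z :
  two_sided_sum (fun z => \sum_j d j * g j z) n z =
  \sum_j d j * two_sided_sum (g j) n z.
Proof.
rewrite /two_sided_sum; under [RHS]eq_bigr do rewrite mulr_sumr.
rewrite exchange_big; apply: eq_bigr => i _; rewrite !mulr_sumr -big_split/=.
by apply: eq_bigr => j _; rewrite mulrDr [lam ^- _ * _]mulrCA [lam ^+ _ * _]mulrCA.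
Qed.

Lemma geometric_sum_le (r : R) n : 0 <= r -> r < 1 ->
  \sum_(i < n) r ^+ i <= (1 - r)^-1.
Proof.
move=> r0 r1; have s0 : 0 < 1 - r by rewrite subr_gt0.
rewrite -[leRHS]mul1r ler_pdivlMr// mulrC.
have -> : (1 - r) * \sum_(i < n) r ^+ i = 1 - r ^+ n.
  by rewrite -opprB -[RHS]opprB subrX1 mulNr.
by rewrite gerDl oppr_le0 exprn_ge0.
Qed.

Hypothesis lam1 : normc lam < 1.

(** The condition on [m] makes the terms decay like [|lam| ^ |k|] on both sides.
The value [v] is [g z] when the term [k = 0] is to be isolated, and [0] when
[g z] is itself part of the bounded remainder. *)
Lemma two_sided_sum_approx (g : R[i] -> R[i]) (m : nat) (K : R) (v z : R[i]) n :
  normc lam ^- 2 <= mu ^+ m ->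
  normc (g z - v) <= K ->
  (forall k, normc (g ((mu ^+ k.+1)%:C * z)) <= K * mu ^- (k.+1 * m)) ->
  (forall k, normc (g ((mu ^- k.+1)%:C * z)) <= K) ->
  normc (two_sided_sum g n.+1 z - lam^-1 * v) <=
  K * ((normc lam)^-1 + 1) / (1 - normc lam).
Proof.
set r := normc lam => lm g0 gp gm.
have r0 : 0 < r.
  rewrite lt_neqAle normc_ge0 andbT eq_sym; apply: contra lam0.
  by move=> /eqP/eq0_normc ->.
have K0 : 0 <= K := le_trans (normc_ge0 _) g0.
have down k : normc (lam ^+ k * g ((mu ^- k.+1)%:C * z)) <= K * r ^+ k.
  by rewrite normcM normcX mulrC ler_wpM2r ?exprn_ge0// ltW.
have up k : normc (lam ^- k.+2 * g ((mu ^+ k.+1)%:C * z)) <= K * r^-1 * r ^+ k.+1.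
  rewrite normcM normcV normcX -/r.
  apply: le_trans (ler_wpM2l _ (gp k)) _; first by rewrite invr_ge0 exprn_ge0// ltW.
  have h : mu ^- (k.+1 * m) <= r ^+ (2 * k.+1).
    rewrite -[leRHS]invrK lef_pV2 ?posrE ?exprn_gt0 ?invr_gt0 ?exprn_gt0//.
    rewrite [(k.+1 * m)%N]mulnC !exprM -exprVn lerXn2r// nnegrE ?invr_ge0 ?exprn_ge0 ?(ltW r0) ?(ltW mu0)//.
  rewrite mulrCA -mulrA; apply: ler_wpM2l => //.
  apply: le_trans (ler_wpM2l _ h) _; first by rewrite invr_ge0 exprn_ge0// ltW.
  rewrite le_eqVlt; apply/orP; left; apply/eqP.
  rewrite mul2n -addnn exprD !exprS; field.
  by rewrite expf_neq0 gt_eqF.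
rewrite /two_sided_sum big_ord_recl/= !expr0 mul1r expr1.
rewrite [1%:C * z]mul1r.
set s := \sum_(i < n) _.
have -> : lam^-1 * g z + g ((mu^-1)%:C * z) + s - lam^-1 * v =
   (lam^-1 * (g z - v) + g ((mu^-1)%:C * z)) + s by ring.
apply: (@le_trans _ _ (\sum_(i < n.+1) K * (r^-1 + 1) * r ^+ i)); last first.
  rewrite -mulr_sumr; apply: ler_wpM2l.
    by rewrite mulr_ge0// addr_ge0// invr_ge0 ltW.
  by apply: geometric_sum_le => //; exact: ltW.
rewrite big_ord_recl expr0 mulr1; apply: le_trans (ler_normcD _ _) _; apply: lerD.
  apply: le_trans (ler_normcD _ _) _; rewrite [K * _]mulrDr mulr1; apply: lerD.
    by rewrite normcM normcV -/r mulrC ler_wpM2r// invr_ge0 ltW.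
  by have := gm 0%N; rewrite expr1.
apply: le_trans (normc_sum _ _ _) _; apply: ler_sum => i _.
rewrite /= /bump /= add1n [K * _]mulrDr mulr1 mulrDl; apply: le_trans (ler_normcD _ _) _.
by apply: lerD; [exact: up|exact: down].
Qed.

End two_sided_sum.

Lemma power_gap (R : realType) (q : R) (a b : nat) : 1 < q -> a != b ->
  (1 - q^-1) * q ^+ a <= `|q ^+ a - q ^+ b|.
Proof.
move=> q1; have q0 : 0 < q by exact: lt_trans q1.
have qi : 0 < q^-1 <= 1 by rewrite invr_gt0 q0 invf_le1// ltW.
rewrite neq_ltn => /orP[ab|ba].
- rewrite distrC; apply: le_trans (ler_norm _).
  apply: le_trans (_ : (q - 1) * q ^+ a <= _).
    rewrite ler_wpM2r ?exprn_ge0 ?(ltW q0)//.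
    have -> : 1 - q^-1 = (q - 1) * q^-1 by field; rewrite gt_eqF.
    by rewrite ler_piMr ?subr_ge0 ?(ltW q1)//; case/andP: qi.
  by rewrite mulrBl mul1r lerD2r -exprS ler_weXn2l// ltW.
- apply: le_trans (ler_norm _); rewrite mulrBl mul1r lerD2l lerN2.
  case: a ba => // a ba; rewrite exprS mulKf ?gt_eqF// ler_weXn2l// ltW//.
Qed.

(** * A family with independent two-sided sums *)

Section poles.
Variables (R : realType) (mu q eta : R) (N : nat).
Hypotheses (q1 : 1 < q) (qmu : q ^+ N.+1 = mu) (eta0 : 0 < eta).
Hypothesis (eta_small : 2 * eta <= 1 - q^-1).
Let del := (1 - q^-1) / 2.
Let q0 : 0 < q. Proof. exact: lt_trans q1. Qed.
Let mu0 : 0 < mu. Proof. by rewrite -qmu exprn_gt0. Qed.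
Let del0 : 0 < del.
Proof. by rewrite divr_gt0// subr_gt0 invf_lt1. Qed.
Let del_eta : eta <= del. Proof. by rewrite ler_pdivlMr// mulrC. Qed.
Let delE : 1 - q^-1 = del + del. Proof. by rewrite /del -splitr. Qed.

Definition pole (j : 'I_N.+1) : R[i] := eta +i* - q ^+ j.

Let pow_ge1 k : 1 <= q ^+ k. Proof. by rewrite exprn_ege1// ltW. Qed.

(** The exponents of [mu ^ k * q ^ i = q ^ (k (N+1) + i)] and [q ^ j] differ unless
[k = 0] and [i = j]; distinct powers of [q] are far apart ([power_gap]), and the
displacement [mu ^ k * eta] is at most half of the gap. *)
Lemma pole_dist_up (i j : 'I_N.+1) (k : nat) (u v : R) :
  ((i : nat) != j) || (0 < k)%N -> `|v - q ^+ i| <= eta ->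
  del * mu ^+ k <= normc ((mu ^+ k)%:C * (u +i* v) + pole j).
Proof.
move=> ijk vi; apply: le_trans (ler_Im_normc _); rewrite raddfD scale_complexE /=.
have ne : (k * N.+1 + i)%N != j.
  case: k ijk => [|k _]; first by rewrite orbF.
  by rewrite neq_ltn orbC (leq_trans (ltn_ord j))// mulSn -addnA leq_addr.
have := power_gap q1 ne; rewrite exprD mulnC exprM qmu delE => gap.
have m0 : 0 < mu ^+ k by rewrite exprn_gt0.
have h1 : del * mu ^+ k + del * mu ^+ k <= `|mu ^+ k * q ^+ i - q ^+ j|.
  apply: le_trans gap; rewrite -mulrDl ler_wpM2l ?addr_ge0 ?(ltW del0)//.
  by rewrite ler_peMr// ltW.
have h2 : `|mu ^+ k * v - mu ^+ k * q ^+ i| <= del * mu ^+ k.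
  rewrite -mulrBr normrM gtr0_norm// mulrC ler_wpM2r ?(ltW m0)//.
  exact: le_trans vi del_eta.
have h3 := ler_distD (mu ^+ k * v) (mu ^+ k * q ^+ i) (q ^+ j).
rewrite distrC in h2; lra.
Qed.

(** Same argument as for [pole_dist_up], after multiplication by [mu ^ (k+1)]: now
it is the exponent of [q ^ j] that is the larger one, so the gap does not
shrink with [k]. *)
Lemma pole_dist_down (i j : 'I_N.+1) (k : nat) (u v : R) :
  `|v - q ^+ i| <= eta ->
  del <= normc ((mu ^- k.+1)%:C * (u +i* v) + pole j).
Proof.
move=> vi; apply: le_trans (ler_Im_normc _); rewrite raddfD scale_complexE /=.
have ne : (k.+1 * N.+1 + j)%N != i.
  by rewrite neq_ltn orbC (leq_trans (ltn_ord i))// mulSn -addnA leq_addr.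
have := power_gap q1 ne; rewrite exprD mulnC exprM qmu delE.
set M := mu ^+ k.+1 => gap.
have M0 : 0 < M by rewrite exprn_gt0.
have M1 : M^-1 <= 1.
  by rewrite invf_le1// exprn_ege1// -qmu.
have h1 : del + del <= `|M^-1 * q ^+ i - q ^+ j|.
  rewrite -(ler_pM2l M0) -{2}(gtr0_norm M0) -normrM mulrBr mulrA divff ?gt_eqF//.
  rewrite mul1r distrC; apply: le_trans gap; rewrite mulrC mulrA.
  by rewrite ler_peMr// mulr_ge0 ?addr_ge0 ?(ltW del0) ?(ltW M0).
have h2 : `|M^-1 * v - M^-1 * q ^+ i| <= del.
  rewrite -mulrBr normrM gtr0_norm ?invr_gt0//.
  apply: le_trans del_eta; apply: le_trans vi.
  by rewrite ler_piMl.
have h3 := ler_distD (M^-1 * v) (M^-1 * q ^+ i) (q ^+ j).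
rewrite distrC in h2; lra.
Qed.

Lemma pole_dist_near (i : 'I_N.+1) (u v : R) : eta <= u <= 2 * eta ->
  `|v - q ^+ i| <= eta -> 0 < normc ((u +i* v) + pole i) <= 4 * eta.
Proof.
move=> /andP[u1 u2] vi; have ue : 0 < u + eta.
  by rewrite addr_gt0// (lt_le_trans eta0).
apply/andP; split.
  by apply: lt_le_trans (ler_Re_normc _); rewrite raddfD /= gtr0_norm.
apply: le_trans (normc_le_ReIm _) _; rewrite !raddfD /= gtr0_norm//.
have -> : 4 * eta = (2 * eta + eta) + eta by ring.
by apply: lerD => //; rewrite lerD2r.
Qed.

End poles.

Section test_family.
Variables (R : realType) (nu : {measure set (measurableTypeR R) -> \bar R}).
Hypotheses (hreg : regular_borel nu) (hdbl : doubling nu).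
Variables (mu : R) (lam : R[i]).
Hypotheses (mu1 : 1 < mu) (lam0 : lam != 0) (lam1 : normc lam < 1).

(** The order of choices matters: [m] from the doubling constant and [lam], then [q]
from [N], which fixes the bound [C0] of the off-diagonal sums, and only then
[eta], so small that the diagonal term beats [N + 1] times [C0]. *)
Lemma test_family (N : nat) :
  exists (x : 'I_N.+1 -> halfplane R -> R[i]) (y : 'I_N.+1 -> R) (eta : R),
  0 < eta /\ (forall j, zen_space nu (x j)) /\
  forall (i : 'I_N.+1) (d : 'I_N.+1 -> R[i]) n u v,
    normc (d i) = 1 -> (forall j, normc (d j) <= 1) ->
    eta <= u <= 2 * eta -> `|v - y i| <= eta ->
    1 <= normc (\sum_j d j * two_sided_sum mu lam (extend (x j)) n.+1 (u +i* v)).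
Proof.
have mu0 : 0 < mu by exact: lt_trans mu1.
have r0 : 0 < normc lam.
  rewrite lt_neqAle normc_ge0 andbT eq_sym; apply: contra lam0.
  by move=> /eqP/eq0_normc ->.
pose q := expR (ln mu / N.+1%:R).
have q1 : 1 < q by rewrite expR_gt1 divr_gt0// ln_gt0.
have qmu : q ^+ N.+1 = mu.
  by rewrite -expRM_natl mulrCA divff ?mulr1 ?lnK ?posrE// pnatr_eq0.
pose del := (1 - q^-1) / 2.
have del0 : 0 < del by rewrite divr_gt0// subr_gt0 invf_lt1// (lt_trans ltr01).
have [p pzen] := pole_function_zen hreg hdbl.
have [m pm lm] : exists2 m, (p < m)%N & normc lam ^- 2 <= mu ^+ m.
  pose x := normc lam ^- 2.
  have [n xn] : exists n, x <= mu ^+ n.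
    have x0 : 0 < x by rewrite invr_gt0 exprn_gt0.
    exists (Num.truncn (ln x / ln mu)).+1.
    rewrite -ler_ln ?posrE ?exprn_gt0// lnXn// -mulr_natl -ler_pdivrMr ?ln_gt0//.
    exact/ltW/truncnS_gt.
  exists (p.+1 + n)%N; first by rewrite ltn_addr.
  by apply: le_trans xn _; rewrite ler_weXn2l ?(ltW mu1)// leq_addl.
pose K := del^-1 ^+ m.
pose C0 := K * ((normc lam)^-1 + 1) / (1 - normc lam).
have C00 : 0 <= C0.
  apply: divr_ge0; last by rewrite subr_ge0 ltW.
  by rewrite mulr_ge0 ?exprn_ge0// ?addr_ge0// invr_ge0 ltW.
pose B := 1 + N.+1%:R * C0.
have B1 : 1 <= B by rewrite lerDl mulr_ge0.
(* [eta <= del] keeps the other poles at a distance; [4 * eta <= 1 / B] makes the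
   diagonal term at least [B], which leaves [1] after subtracting the rest. *)
pose eta := Num.min del (B^-1 / 4).
have eta0 : 0 < eta by rewrite lt_min del0 divr_gt0// invr_gt0 (lt_le_trans ltr01).
have eta_del : 2 * eta <= 1 - q^-1.
  by rewrite mulrC -ler_pdivlMr// ge_min lexx.
have B0 : 0 < B by exact: lt_le_trans B1.
have eta_B : B <= (4 * eta)^-1 ^+ m.
  have eB : B <= (4 * eta)^-1.
    rewrite -[leLHS]invrK lef_pV2 ?posrE ?invr_gt0// ?mulr_gt0//.
    by rewrite mulrC -ler_pdivlMr// ge_min lexx orbT.
  apply: (le_trans (eB)); rewrite -[leLHS]expr1 ler_weXn2l//.
    by apply: le_trans eB; exact: B1.
  exact: leq_trans pm.
exists (fun j => pole_function (pole q eta j) m), (fun j => q ^+ j), eta.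
split=> //; split=> [j|i d n u v di dle uE vE]; first by apply: pzen => //.
have u0 : 0 < u by case/andP: uE => h _; exact: lt_le_trans h.
have ext (j : 'I_N.+1) (c : R) : 0 < c -> extend (pole_function (pole q eta j) m) (c%:C * (u +i* v)) =
    (c%:C * (u +i* v) + pole q eta j)^-1 ^+ m.
  by move=> c0; rewrite extend_pole_function// scale_complexE/= mulr_gt0.
have upb (j : 'I_N.+1) k : ((i : nat) != j) || (0 < k)%N ->
    normc (extend (pole_function (pole q eta j) m) ((mu ^+ k)%:C * (u +i* v))) <=
    K * mu ^- (k * m).
  move=> ijk; rewrite ext ?exprn_gt0// normcX normcV /K exprM -exprVn -exprMn -invfM.
  have M0 : 0 < del * mu ^+ k by rewrite mulr_gt0// exprn_gt0.
  have h : del * mu ^+ k <= normc ((mu ^+ k)%:C * (u +i* v) + pole q eta j).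
    exact: (pole_dist_up q1 qmu eta_del _ ijk vE).
  rewrite lerXn2r ?nnegrE ?invr_ge0 ?(ltW M0) ?normc_ge0//.
  by rewrite lef_pV2 ?posrE// (lt_le_trans M0).
have downb (j : 'I_N.+1) k :
    normc (extend (pole_function (pole q eta j) m) ((mu ^- k.+1)%:C * (u +i* v))) <= K.
  rewrite ext ?invr_gt0 ?exprn_gt0// normcX normcV /K.
  have h : del <= normc ((mu ^- k.+1)%:C * (u +i* v) + pole q eta j).
    exact: (pole_dist_down q1 qmu eta_del _ _ _ vE).
  rewrite lerXn2r ?nnegrE ?invr_ge0 ?(ltW del0) ?normc_ge0//.
  by rewrite lef_pV2 ?posrE// (lt_le_trans del0).
pose g (j : 'I_N.+1) := extend (pole_function (pole q eta j) m).
pose val j := if j == i then g i (u +i* v) else 0.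
have approx j : normc (two_sided_sum mu lam (g j) n.+1 (u +i* v) - lam^-1 * val j) <= C0.
  apply: (two_sided_sum_approx mu1 lam0 lam1 n lm) => //.
  - rewrite /val; have [->|ji] := eqVneq j i.
      by rewrite subrr normc0 exprn_ge0// invr_ge0 ltW.
    rewrite subr0; have := upb j 0%N; rewrite !expr0 [1%:C * _]mul1r invr1 mulr1.
    apply; rewrite orbF; apply: contra ji => /eqP ij; apply/eqP; exact: val_inj.
  - by move=> k; apply: upb; rewrite orbT.
  - exact: downb.
have main : B <= normc (lam^-1 * g i (u +i* v)).
  have /andP[n1 n2] := pole_dist_near eta0 uE vE.
  rewrite /g -[u +i* v]mul1r -[1]/((1 : R)%:C) ext// [1%:C * _]mul1r.
  rewrite normcM normcX !normcV; apply: le_trans eta_B _.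
  rewrite -[leLHS]mul1r ler_pM ?exprn_ge0 ?invr_ge0 ?mulr_ge0 ?(ltW eta0)//.
    by rewrite -invr1 lef_pV2 ?posrE// ltW.
  rewrite lerXn2r ?nnegrE ?invr_ge0 ?mulr_ge0 ?(ltW eta0) ?normc_ge0//.
  by rewrite lef_pV2 ?posrE// mulr_gt0.
have sumE : \sum_j d j * two_sided_sum mu lam (g j) n.+1 (u +i* v) =
  d i * (lam^-1 * g i (u +i* v)) +
  \sum_j d j * (two_sided_sum mu lam (g j) n.+1 (u +i* v) - lam^-1 * val j).
  under [X in _ = _ + X]eq_bigr do rewrite mulrBr.
  rewrite sumrB addrCA (bigD1 i)//= [X in _ + (_ - X)](bigD1 i)//=.
  rewrite [X in _ - (_ + X)]big1 ?addr0 => [|j /negbTE ji]; last first.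
    by rewrite /val ji !mulr0.
  by rewrite /val eqxx subrr addr0.
set S2 := \sum_j d j * (_ - _) in sumE.
have S2C : normc S2 <= N.+1%:R * C0.
  apply: le_trans (normc_sum _ _ _) _.
  apply: (@le_trans _ _ (\sum_(j < N.+1) C0)); last by rewrite sumr_const card_ord mulr_natl.
  apply: ler_sum => j _; rewrite normcM -[leRHS]mul1r.
  by rewrite ler_pM ?normc_ge0.
rewrite [X in normc X]sumE; apply: (@le_trans _ _ (B - N.+1%:R * C0)).
  by rewrite /B addrK.
apply: (@le_trans _ _ (normc (d i * (lam^-1 * g i (u +i* v))) - normc S2)).
  by rewrite lerB// normcM di mul1r.
rewrite lerBlDr -(normcN S2); apply: le_trans (ler_normcD _ _).
by rewrite addrK.
Qed.


End test_family.

(** * Integration over boxes, and a null combination *)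

(** More rows than columns give a nonzero row in the left kernel; dividing by its
entry of largest modulus normalizes it. *)
Lemma null_combination (R : realType) (N : nat) (c : 'I_N.+1 -> 'I_N -> R[i]) :
  exists (i : 'I_N.+1) (d : 'I_N.+1 -> R[i]),
  [/\ d i = 1, forall j, normc (d j) <= 1 & forall k, \sum_j d j * c j k = 0].
Proof.
pose A : 'M[R[i]]_(N.+1, N) := \matrix_(j, k) c j k.
have : kermx A != 0.
  by rewrite -mxrank_eq0 mxrank_ker subn_eq0 -ltnNge ltnS rank_leq_col.
move=> /rowV0Pn[w /sub_kermxP wA w0].
pose i := [arg max_(i > ord0) normc (w ord0 i)]%O.
have imax j : normc (w ord0 j) <= normc (w ord0 i).
  by rewrite /i; case: arg_maxP => // k _; apply.
have wi : w ord0 i != 0.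
  apply: contra w0 => /eqP wi; apply/eqP/rowP => j; rewrite mxE.
  apply: eq0_normc; apply/eqP; rewrite eq_le normc_ge0 andbT.
  by have := imax j; rewrite wi normc0.
exists i, (fun j => (w ord0 i)^-1 * w ord0 j); split => [|j|k].
- by rewrite mulVf.
- have ni : 0 < normc (w ord0 i) by rewrite -ltcR -normcE normr_gt0.
  by rewrite normcM normcV mulrC ler_pdivrMr// mul1r.
- under eq_bigr do rewrite -mulrA.
  rewrite -mulr_sumr; have := congr1 (fun M : 'rV_N => M ord0 k) wA.
  rewrite !mxE => E; rewrite [X in _ * X](_ : _ = 0) ?mulr0// -[RHS]E.
  by apply: eq_bigr => j _; rewrite mxE.
Qed.

Section box_integral.
Variables (R : realType) (nu : {measure set (measurableTypeR R) -> \bar R}).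
Hypotheses (hreg : regular_borel nu) (hdbl : doubling nu).
Local Notation leb := (@lebesgue_measure R).
Local Notation V := (initial_mass nu).
Let T := measurableTypeR R.

Definition box (x1 x2 y1 y2 : R) : set (T * T) :=
  `[x1, x2]%classic `*` `[y1, y2]%classic.

Lemma measurable_box x1 x2 y1 y2 : measurable (box x1 x2 y1 y2).
Proof. by apply: measurableX; exact: measurable_itv. Qed.

Lemma measurable_sqmod_scale F c x1 x2 y1 y2 : analytic F -> 0 < c -> 0 < x1 ->
  measurable_fun (box x1 x2 y1 y2)
    (fun p : T * T => (sqmod F (c * p.1, c * p.2)%R)%:E).
Proof.
move=> aF c0 x10; apply/measurable_EFinP.
apply: (@measurable_comp _ _ _ _ _ _ [set p : T * T | (0 : R) < p.1] (sqmod F)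
  _ (fun p : T * T => (c * p.1, c * p.2) : T * T)).
- by apply: open_measurable_plane; exact: open_right_halfplane.
- move=> _ [[x y] [/= xI _] <-] /=; move: xI; rewrite in_itv/= => /andP[h _].
  by rewrite mulr_gt0// (lt_le_trans x10).
- exact: measurable_sqmod.
- by apply: measurable_funTS; apply: measurable_fun_pair; exact: measurable_funM.
Qed.

(** The bound of [box_area_bound], over the product measure, for which sums of
integrals are easier to handle. *)
Lemma zen_box_bound F : zen_space nu F ->
  exists2 M : R, 0 <= M & forall c x1 x2 y1 y2, 0 < c -> 0 < x1 -> x1 < x2 ->
  (\int[(leb \x leb)%E]_(p in box x1 x2 y1 y2) (sqmod F (c * p.1, c * p.2)%R)%:E
   <= (x2 * M / (c * V (c * x1)))%:E)%E.
Proof.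
case=> aF /(zen_norm_ltyP nu)[M FM]; exists M.
  rewrite -lee_fin; apply: le_trans (FM 1 ltr01); apply: integral_ge0 => p _.
  by rewrite lee_fin sqmod_ge0.
move=> c x1 x2 y1 y2 c0 x10 x12.
apply: le_trans (box_area_bound hreg hdbl aF FM y1 y2 c0 x10 x12).
have mB := measurable_box x1 x2 y1 y2.
have mf := (measurable_restrictT _ mB).1 (@measurable_sqmod_scale F c x1 x2 y1 y2 aF c0 x10).
rewrite [leLHS]integral_mkcond fubini_tonelli1//; last first.
  by move=> p; rewrite /patch; case: ifP => // _; rewrite lee_fin sqmod_ge0.
rewrite [leRHS]integral_mkcond; apply: ge0_integral_mono => x _.
  apply: integral_ge0 => y _.
  by rewrite /patch; case: ifP => // _; rewrite lee_fin sqmod_ge0.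
rewrite /fubini_F [leRHS]/patch; case: ifPn => [/[!inE] xI|/negP xI].
  rewrite [leRHS]integral_mkcond; apply: ge0_integral_mono => y _.
    by rewrite /patch; case: ifP => // _; rewrite lee_fin sqmod_ge0.
  rewrite /patch; case: ifPn => [/[!inE] -[_ /= yI]|_]; first by rewrite ifT ?inE.
  by case: ifP => // _; rewrite lee_fin sqmod_ge0.
rewrite integral0_eq// => y _; rewrite /patch ifF//; apply/negP => /[!inE] -[/= xI' _].
by apply: xI; rewrite inE.
Qed.

Lemma box_measure x1 x2 y1 y2 : x1 < x2 -> y1 < y2 ->
  (leb \x leb)%E (box x1 x2 y1 y2) = ((x2 - x1) * (y2 - y1))%:E.
Proof.
move=> x12 y12; rewrite product_measure1E//=; do ?exact: measurable_itv.
by rewrite !lebesgue_measure_itv/= !lte_fin x12 y12 EFinM !EFinB.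
Qed.

Lemma initial_mass_scale eta : 0 < eta -> exists2 D : R, 0 < D &
  forall c, 0 < c -> (V (c * eta))^-1 <= D / V c.
Proof.
move=> eta0; have [D D1 VD] := doubling_constant hreg hdbl.
pose r := Num.truncn eta^-1.
have re : 1 <= 2 ^+ r.+1 * eta.
  rewrite -ler_pdivrMr// mul1r; apply: le_trans (ltW (truncnS_gt _)) _.
  by rewrite -natrX ler_nat ltnW// ltn_expl.
exists (D ^+ r.+1) => [|c c0]; first by rewrite exprn_gt0// (lt_le_trans ltr01).
have ce0 : 0 < c * eta by rewrite mulr_gt0.
have V1 := initial_mass_gt0 hreg hdbl c0.
have V2 := initial_mass_gt0 hreg hdbl ce0.
rewrite -[leLHS]mul1r ler_pdivrMr// mulrAC ler_pdivlMr// mul1r.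
apply: le_trans (VD r.+1 _ ce0); apply: (initial_mass_mono hreg).
by rewrite mulrCA ler_peMr// ltW.
Qed.

End box_integral.

(** * The range has infinite codimension *)

(** Sum the inequalities [x <= k * x^2 + 1 / (4 k)], with [k = N + 1], over the
[2 (N + 1)] moduli: the constants add up to [1 / 2]. *)
Lemma combination_ge1_sqr (R : realType) (N : nat) (d p r : 'I_N.+1 -> R[i]) :
  (forall j, normc (d j) <= 1) ->
  1 <= normc (\sum_j d j * (p j - r j)) ->
  1 <= \sum_j (2 * N.+1%:R) * (normc (p j) ^+ 2 + normc (r j) ^+ 2).
Proof.
move=> d1 h; pose k : R := N.+1%:R.
have k0 : 0 < k by rewrite ltr0n.
have amgm (x : R) : x <= k * x ^+ 2 + (4 * k)^-1.
  have : 0 <= k * (x - (2 * k)^-1) ^+ 2 by rewrite mulr_ge0 ?sqr_ge0// ltW.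
  have -> : k * (x - (2 * k)^-1) ^+ 2 = k * x ^+ 2 + (4 * k)^-1 - x.
    by field; rewrite gt_eqF.
  by rewrite subr_ge0.
have h1 : 1 <= \sum_(j < N.+1) (k * (normc (p j) ^+ 2 + normc (r j) ^+ 2) + (2 * k)^-1).
  apply: le_trans h _; apply: le_trans (normc_sum _ _ _) _; apply: ler_sum => j _.
  rewrite normcM; apply: (@le_trans _ _ (normc (p j - r j))).
    by rewrite ler_piMl ?normc_ge0.
  apply: le_trans (ler_normcD _ _) _; rewrite normcN.
  have -> : (2 * k)^-1 = (4 * k)^-1 + (4 * k)^-1 by field; rewrite gt_eqF.
  by rewrite mulrDr addrACA; apply: lerD; exact: amgm.
rewrite big_split/= sumr_const card_ord -[_ *+ N.+1]mulr_natl -/k in h1.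
have e : k * (2 * k)^-1 = 2^-1 by field; rewrite gt_eqF.
rewrite e in h1; under eq_bigr do rewrite -/k -mulrA.
rewrite -mulr_sumr; lra.
Qed.

Section main.
Variables (R : realType) (nu : {measure set (measurableTypeR R) -> \bar R}).
Hypotheses (hreg : regular_borel nu) (hdbl : doubling nu).
Variables (mu : R) (hmu : 1 < mu) (alpha : R[i]).
Hypothesis halpha : (\int[@lebesgue_measure R]_(t in `]0%R, +oo[%classic)
  (((normc (cpow t alpha)) ^+ 2)%:E / weight nu t) < +oo)%E.
Variable phi : halfplane R -> halfplane R.
Hypothesis hphi : forall s : halfplane R, val (phi s) = mu%:C * val s.
Let lam := cpow mu alpha.
Let mu0 : 0 < mu. Proof. exact: lt_trans hmu. Qed.
Local Notation leb := (@lebesgue_measure R).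
Let T := measurableTypeR R.

Lemma extend_composition (h : halfplane R -> R[i]) z : 0 < complex.Re z ->
  extend (composition_op phi h - lam *: h) z =
  extend h (mu%:C * z) - lam * extend h z.
Proof.
move=> z0; have mz0 : 0 < complex.Re (mu%:C * z) by rewrite scale_complexE/= mulr_gt0.
rewrite /extend !insubT /= /composition_op /=.
rewrite -[LHS]/(h (phi (Sub z z0)) - lam * h (Sub z z0)).
by congr (h _ - _); apply: val_inj; rewrite hphi.
Qed.

Lemma range_infinite_codim :
  ~ finite_dim_mod (zen_space nu)
      ((fun h => composition_op phi h - lam *: h) @` zen_space nu).
Proof.
move=> [N [v [_ span]]].
have lam1 : normc lam < 1 by exact: (normc_cpow_lt1 hreg hdbl hmu halpha).
have lam0 : lam != 0.
  apply/eqP => l0; have := expR_gt0 (complex.Re alpha * ln mu).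
  by rewrite -normc_cpow -/lam l0 normc0 ltxx.
have [x [y [eta [eta0 [xzen xlow]]]]] := test_family hreg hdbl hmu lam0 lam1 N.
have /choice[cf /choice[h hP]] : forall j, exists c : 'I_N -> R[i],
    exists h : halfplane R -> R[i], zen_space nu h /\
      composition_op phi h - lam *: h = x j - \sum_(i < N) c i *: v i.
  move=> j; have [c [h zh hE]] := span _ (xzen j).
  by exists c, h.
(* The combination [d] of the [x j] lies in the range of [T]. *)
have [i [d [di dle dc]]] := null_combination cf.
have sumE z : 0 < complex.Re z ->
  \sum_j d j * extend (x j) z =
  \sum_j d j * extend (composition_op phi (h j) - lam *: h j) z.
  move=> z0; pose s : halfplane R := exist _ z z0.
  have ext F : extend F z = F s.
    by rewrite /extend insubT /=; congr (F _); exact: val_inj.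
  under eq_bigr do rewrite ext; under [RHS]eq_bigr do rewrite ext (hP _).2.
  have ev j : (x j - \sum_(k < N) cf j k *: v k) s =
      x j s - \sum_(k < N) cf j k * v k s.
    rewrite -[LHS]/(x j s - (\sum_(k < N) cf j k *: v k) s) fct_sumE.
    by [].
  under [RHS]eq_bigr do rewrite ev mulrBr mulr_sumr.
  rewrite sumrB exchange_big/= [X in _ - X]big1 ?subr0// => k _.
  under eq_bigr do rewrite mulrA.
  by rewrite -mulr_suml dc mul0r.
have telescope n z : 0 < complex.Re z ->
  \sum_j d j * two_sided_sum mu lam (extend (x j)) n z =
  \sum_j d j * (lam ^- n * extend (h j) ((mu ^+ n)%:C * z) -
                lam ^+ n * extend (h j) ((mu ^- n)%:C * z)).
  move=> z0; rewrite -two_sided_sum_linear.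
  rewrite (@two_sided_sum_telescope _ _ _ hmu lam0 _ (fun z => \sum_j d j * extend (h j) z))//.
    rewrite !mulr_sumr -sumrB; apply: eq_bigr => j _.
    by rewrite mulrBr; congr (_ - _); rewrite mulrCA.
  move=> k k0; have kz0 : 0 < complex.Re (k%:C * z) by rewrite scale_complexE/= mulr_gt0.
  rewrite sumE// mulr_sumr -sumrB; apply: eq_bigr => j _.
  rewrite extend_composition// mulrBr mulrA -rmorphM.
  by congr (_ - _); rewrite mulrCA.
have /choice[M MP] : forall j, exists M : R, 0 <= M /\
    forall c x1 x2 y1 y2, 0 < c -> 0 < x1 -> x1 < x2 ->
    (\int[(leb \x leb)%E]_(p in box x1 x2 y1 y2)
      (sqmod (h j) (c * p.1, c * p.2)%R)%:E
     <= (x2 * M / (c * initial_mass nu (c * x1)))%:E)%E.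
  by move=> j; have [M M0 MP] := zen_box_bound hreg hdbl (hP j).1; exists M.
have [D D0 VD] := initial_mass_scale hreg hdbl eta0.
pose B := box eta (2 * eta) (y i - eta) (y i + eta).
pose r := normc lam.
have r0 : 0 < r by rewrite /r normc_cpow expR_gt0.
have normE q (z : R[i]) :
    normc (lam ^+ q * z) ^+ 2 = r ^+ (q * 2) * normc z ^+ 2.
  by rewrite normcM normcX exprMn -exprM.
have normVE q (z : R[i]) :
    normc (lam ^- q * z) ^+ 2 = r^-1 ^+ (q * 2) * normc z ^+ 2.
  by rewrite normcM normcV normcX exprMn exprM !exprVn.
have lower n : ((2 * eta - eta) * (y i + eta - (y i - eta)) <=
  \sum_(j < N.+1) (2 * N.+1%:R) * (2 * eta * M j * D *
     (decay_rate nu alpha (mu ^+ n.+1) + decay_rate nu alpha (mu ^- n.+1)))).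
  rewrite -lee_fin -box_measure; [|lra|lra].
  rewrite -[leLHS]mul1e -integral_cst; last exact: measurable_box.
  set m := n.+1; pose k : R := 2 * N.+1%:R.
  have k0 : 0 <= k by rewrite mulr_ge0.
  pose s j (c : R) (p : T * T) : \bar R := (sqmod (h j) (c * p.1, c * p.2)%R)%:E.
  have s0 j c p : (0 <= s j c p)%E by rewrite lee_fin sqmod_ge0.
  have ms j c : 0 < c -> measurable_fun B (s j c).
    by move=> c0; apply: measurable_sqmod_scale => //; exact: (hP j).1.1.
  have mp0 : 0 < mu ^+ m by rewrite exprn_gt0.
  have mm0 : 0 < mu ^- m by rewrite invr_gt0.
  pose g j (p : T * T) : \bar R := (k%:E * ((r^-1 ^+ (m * 2))%:E * s j (mu ^+ m)%R p +
    (r ^+ (m * 2))%:E * s j (mu ^- m)%R p))%E.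
  have rp0 : 0 <= r^-1 ^+ (m * 2) by rewrite exprn_ge0// invr_ge0 ltW.
  have rm0 : 0 <= r ^+ (m * 2) by rewrite exprn_ge0// ltW.
  have g0 j p : (0 <= g j p)%E.
    apply: mule_ge0; first by rewrite lee_fin.
    by apply: adde_ge0; apply: mule_ge0 => //; rewrite lee_fin.
  have mB : measurable B by exact: measurable_box.
  have mg1 j : measurable_fun B (fun p => (r^-1 ^+ (m * 2))%:E * s j (mu ^+ m)%R p)%E.
    by apply: emeasurable_funM => //; exact: ms.
  have mg2 j : measurable_fun B (fun p => (r ^+ (m * 2))%:E * s j (mu ^- m)%R p)%E.
    by apply: emeasurable_funM => //; exact: ms.
  have mg12 j := emeasurable_funD (mg1 j) (mg2 j).
  apply: (@le_trans _ _ (\int[(leb \x leb)%E]_(p in B) \sum_(j < N.+1) g j p)%E).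
    apply: ge0_integral_mono => -[u w] [/= uI wI]; first by rewrite lee_fin.
    have u0 : 0 < u by move: uI; rewrite in_itv/= => /andP[h1 _]; exact: lt_le_trans h1.
    have := xlow i d n u w; rewrite di normc1 -/m telescope// => low.
    have {}low := combination_ge1_sqr dle (low erefl dle _ _).
    rewrite (_ : \sum_(j < N.+1) g j (u, w) = (\sum_(j < N.+1)
        k * (r^-1 ^+ (m * 2) * sqmod (h j) (mu ^+ m * u, mu ^+ m * w)%R +
        r ^+ (m * 2) * sqmod (h j) (mu ^- m * u, mu ^- m * w)%R)%R)%:E)%E; last first.
      by rewrite -sumEFin.
    rewrite lee_fin.
    have -> : \sum_(j < N.+1) k * (r^-1 ^+ (m * 2) * sqmod (h j) (mu ^+ m * u, mu ^+ m * w) +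
        r ^+ (m * 2) * sqmod (h j) (mu ^- m * u, mu ^- m * w)) =
      \sum_(j < N.+1) 2 * N.+1%:R *
        (normc (lam ^- m * extend (h j) ((mu ^+ m)%:C * (u +i* w))) ^+ 2 +
         normc (lam ^+ m * extend (h j) ((mu ^- m)%:C * (u +i* w))) ^+ 2).
      apply: eq_bigr => j _; rewrite /sqmod !scale_complexE/= -/k.
      by rewrite normE normVE.
    apply: low; first by move: uI; rewrite in_itv.
    by move: wI; rewrite in_itv/= ler_distl.
  rewrite ge0_integral_sum//; last first.
    by move=> j; apply: emeasurable_funM.
  rewrite -sumEFin; apply: lee_sum => j _.
  have [Mj MP'] := MP j.
  have rate z w : 0 < z -> 0 <= w -> (w%:E * \int[(leb \x leb)%E]_(p in B) s j z p <=
      (2 * eta * M j * D * (w / (z * initial_mass nu z)))%:E)%E.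
    move=> z0 w0; have eta12 : eta < 2 * eta by lra.
    have := MP' z eta (2 * eta) (y i - eta) (y i + eta) z0 eta0 eta12.
    move=> /(lee_wpmul2l _) => /(_ w%:E); rewrite lee_fin => /(_ w0) /le_trans; apply.
    rewrite -EFinM lee_fin.
    have -> : w * (2 * eta * M j / (z * initial_mass nu (z * eta))) =
        (w * (2 * eta * M j) / z) * (initial_mass nu (z * eta))^-1.
      by rewrite invfM; ring.
    have -> : 2 * eta * M j * D * (w / (z * initial_mass nu z)) =
        (w * (2 * eta * M j) / z) * (D / initial_mass nu z).
      by rewrite invfM; ring.
    rewrite ler_wpM2l ?VD// divr_ge0 ?(ltW z0)// mulr_ge0// mulr_ge0// mulr_ge0//.
    exact: ltW.
  rewrite /g ge0_integralZl//; last first.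
  - by move=> p _; apply: adde_ge0; apply: mule_ge0 => //; rewrite lee_fin.
  rewrite ge0_integralD//; last 2 first.
  - by move=> p _; apply: mule_ge0 => //; rewrite lee_fin.
  - by move=> p _; apply: mule_ge0 => //; rewrite lee_fin.
  rewrite !ge0_integralZl//; do ?[exact: ms].
  rewrite [leRHS]EFinM lee_wpmul2l ?lee_fin// mulrDr [leRHS]EFinD.
  apply: leeD.
    by rewrite (decay_rate_expn nu hmu) -/lam -/r; exact: rate.
  by rewrite (decay_rate_expNn nu hmu) -/lam -/r; exact: rate.
pose C := \sum_(j < N.+1) (2 * N.+1%:R) * (2 * eta * M j * D).
have C0 : 0 <= C.
  apply: sumr_ge0 => j _; rewrite !mulr_ge0 ?(ltW D0) ?(ltW eta0)//.
  by case: (MP j).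
(* The box has area [2 * eta ^ 2], which exceeds [C * (e + e)]. *)
pose e := eta ^+ 2 / (C + 1).
have e0 : 0 < e by rewrite divr_gt0 ?exprn_gt0// ltr_wpDl.
have := decay_rate_pow hreg hdbl hmu halpha.
move=> /cvgrPdist_lt/(_ e e0)[n1 _ hn1].
have := decay_rate_pow_inv hreg hdbl hmu halpha.
move=> /cvgrPdist_lt/(_ e e0)[n2 _ hn2].
have /= := hn1 (n1 + n2).+1; have /= := hn2 (n1 + n2).+1.
rewrite !sub0r !normrN => /(_ (leqW (leq_addl _ _))) b2.
move=> /(_ (leqW (leq_addr _ _))) b1.
have {}b1 := le_lt_trans (ler_norm _) b1.
have {}b2 := le_lt_trans (ler_norm _) b2.
have := lower (n1 + n2)%N; apply/negP; rewrite -ltNge.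
set a := decay_rate _ _ _ in b1 *; set b := decay_rate _ _ _ in b2 *.
have -> : (\sum_(j < N.+1) (2 * N.+1%:R) * (2 * eta * M j * D * (a + b))) = C * (a + b).
  by rewrite /C mulr_suml; apply: eq_bigr => j _; ring.
apply: (@le_lt_trans _ _ (C * (e + e))).
  by rewrite ler_wpM2l// lerD// ltW.
have -> : (2 * eta - eta) * (y i + eta - (y i - eta)) = (C + 1) * (e + e).
  by rewrite /e; field; rewrite gt_eqF// ltr_wpDl.
by rewrite ltr_pM2r ?addr_gt0// ltrDl.
Qed.

End main.

Theorem theorem3p4 (R : realType)
    (nu : {measure set (measurableTypeR R) -> \bar R})
    (hsupp : supported_on_nonneg nu) (hreg : regular_borel nu)
    (hdbl : doubling nu)
    (mu : R) (hmu : 1 < mu)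
    (phi : halfplane R -> halfplane R)
    (hphi : forall s : halfplane R, val (phi s) = mu%:C * val s)
    (alpha : R[i])
    (halpha : (\int[@lebesgue_measure R]_(t in `]0%R, +oo[%classic)
                 (((Normc.normc (cpow t alpha)) ^+ 2)%:E / weight nu t) < +oo)%E) :
  essential_spectrum (zen_space nu) (zen_norm nu) (composition_op phi)
    (cpow mu alpha).
Proof.
by case=> _ _; exact: (range_infinite_codim hreg hdbl hmu halpha hphi).
Qed.
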